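(* Let $T=T_{\mathrm{rg}}(\tau;\alpha,\beta)$ be an exceptional Jacobi operator in the rational gauge. Then the spectral diagram of $T$ is related to the spectral diagram of a classical Jacobi operator by a spectral shift and finitely many label changes: there exist $a,b,c\in\mathbb{R}$ such that $\sigma_{\mathrm{qr}}(T)=\{\lambda+c:\lambda\in\sigma_{\mathrm{qr}}(T(a,b))\}$ and the label of $\lambda+c$ for $T$ coincides with the label of $\lambda$ for $T(a,b)$ for all but finitely many $\lambda\in\sigma_{\mathrm{qr}}(T(a,b))$.
   Context: $D=d/dx$; $\eta(x;\alpha,\beta)=\frac{\alpha+1}{x-1}+\frac{\beta+1}{x+1}$. The classical Jacobi operator is $T(a,b)=(x^2-1)(D^2+\eta(x;a,b)D)$. For a polynomial $\tau$ with $\tau(\pm1)\neq0$: $T_{\mathrm{ng}}(\tau;\alpha,\beta)=(x^2-1)\big(D^2-2\frac{\tau'}{\tau}D+\frac{\tau''}{\tau}+\eta(D-\frac{\tau'}{\tau})\big)+2x\frac{\tau'}{\tau}$, $T_{\mathrm{rg}}(\tau;\alpha,\beta)=T(\alpha,\beta)+2(x^2-1)u'+2xu$, $u=\tau'/\tau$. $T_{\mathrm{rg}}(\tau;\alpha,\beta)$ is an exceptional Jacobi operator if $T_{\mathrm{ng}}(\tau;\alpha,\beta)$ has a nonzero polynomial eigenfunction of degree $n$ for all but finitely many $n\in\mathbb{N}_0$. For $T=pD^2+qD+r$ and constant $\lambda$, $\mathrm{Ric}_\lambda(T)$ is the set of rational $w$ with $p(w'+w^2)+qw+r=\lambda$ (log-derivatives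 of quasi-rational eigenfunctions, i.e. eigenfunctions $\phi$ with $\phi'/\phi$ rational), and $\sigma_{\mathrm{qr}}(T)=\{\lambda:\mathrm{Ric}_\lambda(T)\ne\emptyset\}$. Asymptotic type of a rational $w$: 1 if regular at $x=\pm1$; 2 if poles at both; 3 if pole at $x=1$ only; 4 if pole at $x=-1$ only. The label of $\lambda\in\sigma_{\mathrm{qr}}(T)$ is (cardinality of $\mathrm{Ric}_\lambda(T)$, set of asymptotic types of its elements); the spectral diagram is the map $\lambda\mapsto$ label. *)

(* Defs.v *)
From HB Require Import structures.
From mathcomp Require Import all_boot all_order all_algebra.
From mathcomp Require Import reals.
Set Implicit Arguments. Unset Strict Implicit. Unset Printing Implicit Defensive.
Import Order.TTheory GRing.Theory Num.Theory.
Local Open Scope ring_scope.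

Section Defs.
Variable R : realType.

(* A rational function w with real coefficients, in its unique reduced form
   w = P / Q with Q monic and gcd(P,Q) = 1.  Equality of such pairs is
   equality of rational functions. *)
Definition ratfun := {w : {poly R} * {poly R} | (w.2 \is monic) && coprimep w.1 w.2}.
Definition rnum (w : ratfun) : {poly R} := (val w).1.
Definition rden (w : ratfun) : {poly R} := (val w).2.

(* A second-order operator with rational coefficients
     T = p D^2 + q D + r,  with  p = op_p/op_d, q = op_q/op_d, r = op_r/op_d,
   all coefficients written over a common nonzero polynomial denominator op_d. *)
Record rop := ROp { op_p : {poly R}; op_q : {poly R}; op_r : {poly R}; op_d : {poly R} }.

(* w = P/Q is in Ric_lambda(T), i.e. p (w' + w^2) + q w + r = lambda, i.e.
   (multiplying by d Q^2, Q != 0, d != 0)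
   op_p (P'Q - PQ' + P^2) + op_q P Q + op_r Q^2 = lambda op_d Q^2. *)
Definition Ric (T : rop) (lam : R) (w : ratfun) : Prop :=
  let P := rnum w in let Q := rden w in
  op_p T * (P^`() * Q - P * Q^`() + P ^+ 2) + op_q T * P * Q + op_r T * Q ^+ 2
  = lam *: (op_d T * Q ^+ 2).

Definition sigma_qr (T : rop) (lam : R) : Prop := exists w, Ric T lam w.

(* asymptotic type of a rational function (poles at +-1 <-> roots of the
   reduced denominator) *)
Definition atype (w : ratfun) : nat :=
  match root (rden w) 1, root (rden w) (-1) with
  | false, false => 1%N
  | true, true => 2%N
  | true, false => 3%N
  | false, true => 4%N
  end.

Definition same_label (T1 : rop) (lam1 : R) (T2 : rop) (lam2 : R) : Prop :=
  (exists (f : {w | Ric T1 lam1 w} -> {w | Ric T2 lam2 w})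
          (g : {w | Ric T2 lam2 w} -> {w | Ric T1 lam1 w}),
      cancel f g /\ cancel g f) /\
  (forall k : nat, (exists w, Ric T1 lam1 w /\ atype w = k) <->
                   (exists w, Ric T2 lam2 w /\ atype w = k)).

(* (x^2-1) * eta(x;a,b) = (a+1)(x+1) + (b+1)(x-1) *)
Definition eta_num (a b : R) : {poly R} :=
  (a + 1) *: ('X + 1) + (b + 1) *: ('X - 1).

Definition Tjac (a b : R) : rop := ROp ('X ^+ 2 - 1) (eta_num a b) 0 1.

(* T_rg(tau;alpha,beta) = T(alpha,beta) + 2(x^2-1)u' + 2xu, u = tau'/tau;
   u' = (tau'' tau - tau'^2)/tau^2, so everything is put over tau^2. *)
Definition Trg (tau : {poly R}) (al be : R) : rop :=
  ROp (tau ^+ 2 * ('X ^+ 2 - 1)) (tau ^+ 2 * eta_num al be)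
      (2%:R *: (('X ^+ 2 - 1) * (tau^`(2) * tau - tau^`() ^+ 2))
       + 2%:R *: ('X * tau^`() * tau))
      (tau ^+ 2).

(* T_ng(tau;alpha,beta) y = mu y, multiplied through by tau:
   tau(x^2-1)y'' - 2(x^2-1)tau' y' + (x^2-1)tau'' y + eta_num (tau y' - tau' y)
     + 2 x tau' y = mu tau y. *)
Definition Tng_eig (tau : {poly R}) (al be : R) (y : {poly R}) (mu : R) : Prop :=
  tau * ('X ^+ 2 - 1) * y^`(2) - 2%:R *: (('X ^+ 2 - 1) * tau^`() * y^`())
  + ('X ^+ 2 - 1) * tau^`(2) * y
  + eta_num al be * (tau * y^`() - tau^`() * y)
  + 2%:R *: ('X * tau^`() * y)
  = mu *: (tau * y).

Definition exceptional (tau : {poly R}) (al be : R) : Prop :=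
  tau.[1] != 0 /\ tau.[-1] != 0 /\
  exists s : seq nat, forall n : nat, n \notin s ->
    exists (y : {poly R}) (mu : R), y != 0 /\ size y = n.+1 /\ Tng_eig tau al be y mu.

End Defs.

(* Main.v *)
Require Import Defs.
From HB Require Import structures.
From mathcomp Require Import all_boot all_order all_algebra.
From mathcomp Require Import boolp reals.
From mathcomp Require Import ring lra zify.
Set Implicit Arguments. Unset Strict Implicit. Unset Printing Implicit Defensive.
Import Order.TTheory GRing.Theory Num.Theory.
Local Open Scope ring_scope.

(**
  One can take a = alpha, b = beta and c = 0: the exceptional operator
  T_rg(tau; alpha, beta) already has the quasi-rational spectrum of
  T(alpha, beta), and the same labels outside a finite set.

  The space of polynomials on which all iterates of T_ng are polynomial has
  finite codimension, hence contains an ideal (tau^K).  This property ("the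
  roots of tau are apparent singularities for every eigenvalue") survives
  conjugation by (x -+ 1)^s: for integer s it is clear, and the obstruction is
  polynomial in s.  It forces integer local exponents at the roots of tau, so
  every w in Ric_lambda(T) is y'/y - tau'/tau - s/(x-1) - t/(x+1) with a
  polynomial y, s in {0, alpha} and t in {0, beta}.  The growth
  m = deg y - deg tau - s - t at infinity gives lambda = m (m+alpha+beta+1), so
  lambda = lambda_m for some m in Z or m in Z - alpha.

  Conversely let m be an integer.  If T - lambda_m is not injective on the
  invariant polynomial space, there is a solution with s = t = 0.  Otherwise it
  is onto, and the formal solution at infinity of the adjoint equation is
  orthogonal to the ideal (tau^K), hence rational; this is a solution with
  s = alpha and t = beta.  Away from finitely many eigenvalues the types that
  occur depend only on alpha, beta and lambda: the larger exponent is taken at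
  infinity by a degree count, and at x = +-1 too when the parameter there is an
  integer, because the opposite case makes lambda an eigenvalue of a
  finite-dimensional operator.
*)

(** * The operator with denominators cleared, its gauges and its adjoint *)

Section Operator.
Variable R : realType.
Implicit Types (tau h y z P Q : {poly R}) (c lam s a b e : R).

Definition jp : {poly R} := 'X ^+ 2 - 1.
(* (y / tau^c)' = dl tau c y / tau^(c+1), and T_rg maps y / tau^c to
   nop tau h c y / tau^(c+2), where h = (x^2 - 1) eta. *)
Definition dl tau c y := tau * y^`() - c%:P * tau^`() * y.
Definition rpot tau : {poly R} :=
  2 * (jp * (tau^`()^`() * tau - tau^`() ^+ 2) + 'X * tau^`() * tau).
Definition nop tau h c y :=
  jp * dl tau (c + 1) (dl tau c y) + h * tau * dl tau c y + rpot tau * y.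
Definition ricE tau h P Q :=
  tau ^+ 2 * jp * (P^`() * Q - P * Q^`() + P ^+ 2)
  + tau ^+ 2 * h * P * Q + rpot tau * Q ^+ 2.
(** The fraction [P / Q] need not be reduced, so gauge changes can be written without
    renormalizing. *)
Definition ricpq tau h lam P Q := ricE tau h P Q = lam%:P * (tau ^+ 2 * Q ^+ 2).

(* (x^2 - 1) eta for e = 1 or e = -1, with parameter a at e and b at -e. *)
Definition jeta e a b : {poly R} :=
  (a + 1)%:P * ('X + e%:P) + (b + 1)%:P * ('X - e%:P).

Lemma jpE e : e ^+ 2 = 1 -> jp = ('X - e%:P) * ('X + e%:P).
Proof.
move=> e2; rewrite /jp -[1 in LHS]/(1%:P) -e2 polyCM; ring.
Qed.

Lemma Ric_ricpq tau al be lam w :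
  Ric (Trg tau al be) lam w <-> ricpq tau (jeta 1 al be) lam (rnum w) (rden w).
Proof.
rewrite /Ric /ricpq /ricE /= /eta_num /jeta /rpot /jp -!mul_polyC.
set P := rnum w; set Q := rden w.
set u := (X in X = _ <-> _); set v := (X in _ = X <-> _).
set u' := (X in _ <-> X = _); set v' := (X in _ <-> _ = X).
have -> : u = u' by rewrite /u /u'; ring.
by have -> : v = v' by rewrite /v /v'; ring.
Qed.

(** For [tau = 1] the potential vanishes, so every result on [Trg] also applies to the classical
    operator. *)
Lemma Ric_Tjac al be lam w :
  Ric (Tjac al be) lam w <-> Ric (Trg 1 al be) lam w.
Proof.
rewrite /Ric /= !expr1n !derivE.
by rewrite !(mulr0, mul0r, subr0, scaler0, addr0, mul1r, mulr1, expr0n, oppr0) /=.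
Qed.

Lemma nopB tau h c y z : nop tau h c (y - z) = nop tau h c y - nop tau h c z.
Proof. by rewrite /nop /dl !derivE; ring. Qed.
Lemma nopD tau h c y z : nop tau h c (y + z) = nop tau h c y + nop tau h c z.
Proof. by rewrite /nop /dl !derivE; ring. Qed.
Lemma nopZ tau h c k y : nop tau h c (k%:P * y) = k%:P * nop tau h c y.
Proof. by rewrite /nop /dl !derivE; ring. Qed.
Lemma nop0 tau h c : nop tau h c 0 = 0.
Proof. by move: (nopB tau h c 0 0); rewrite !subrr. Qed.

Lemma nop_tau tau h c y : nop tau h (c + 1) (tau * y) = tau * nop tau h c y.
Proof. by rewrite /nop /dl !derivE !polyCD; ring. Qed.

(** The numerator [tau ^+ k * y] with exponent [c + k] stands for the same function as [y] with
    exponent [c]. *)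
Lemma nop_tauX tau h c k y :
  nop tau h (c + k%:R) (tau ^+ k * y) = tau ^+ k * nop tau h c y.
Proof.
elim: k y => [|k IH] y; first by rewrite !expr0 !mul1r addr0.
by rewrite -natr1 addrA exprS -mulrA nop_tau IH mulrA.
Qed.

Lemma ricE_nop tau h c y :
  ricE tau h (dl tau c y) (y * tau) = y * tau ^+ 2 * nop tau h c y.
Proof. by rewrite /ricE /nop /dl !derivE !polyCD; ring. Qed.

Lemma ricE_scale tau h g P Q : ricE tau h (g * P) (g * Q) = g ^+ 2 * ricE tau h P Q.
Proof. by rewrite /ricE !derivE; ring. Qed.

Lemma ricpq_scale tau h lam g P Q : g != 0 ->
  ricpq tau h lam (g * P) (g * Q) <-> ricpq tau h lam P Q.
Proof.
move=> g0; rewrite /ricpq ricE_scale exprMn.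
have -> : lam%:P * (tau ^+ 2 * (g ^+ 2 * Q ^+ 2)) = g ^+ 2 * (lam%:P * (tau ^+ 2 * Q ^+ 2)).
  by ring.
by split=> [/mulfI|->//]; apply; rewrite expf_neq0.
Qed.

Lemma ricpq_cross tau h lam P Q P1 Q1 : Q != 0 -> Q1 != 0 -> P * Q1 = P1 * Q ->
  ricpq tau h lam P Q <-> ricpq tau h lam P1 Q1.
Proof.
move=> Q0 Q10 E; rewrite -(ricpq_scale _ _ _ _ _ Q10) -[X in _ <-> X](ricpq_scale _ _ _ _ _ Q0).
by rewrite (mulrC Q1 P) E (mulrC P1) (mulrC Q1).
Qed.

(** The fraction is the logarithmic derivative of [y / tau^c], which linearizes the Riccati
    equation. *)
Lemma ricpq_nop tau h lam c y : tau != 0 -> y != 0 ->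
  ricpq tau h lam (dl tau c y) (y * tau) <-> nop tau h c y = lam%:P * tau ^+ 2 * y.
Proof.
move=> t0 y0; rewrite /ricpq ricE_nop.
have -> : lam%:P * (tau ^+ 2 * (y * tau) ^+ 2) =
  (y * tau ^+ 2) * (lam%:P * tau ^+ 2 * y) by ring.
by split=> [/mulfI|->//]; apply; rewrite mulf_neq0 ?expf_neq0.
Qed.

(* w = w1 - s / (x - e): conjugation by (x - e)^(-s). *)
Lemma ricpq_gauge tau e a b s lam P Q : e ^+ 2 = 1 -> s * (s - a) = 0 ->
  ricpq tau (jeta e a b) lam (P * ('X - e%:P) - s%:P * Q) (Q * ('X - e%:P)) <->
  ricpq tau (jeta e (a - 2 * s) b) (lam + s * (b + 1)) P Q.
Proof.
move=> e2 sa; have d0 : ('X - e%:P : {poly R}) != 0 by rewrite polyXsubC_eq0.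
rewrite /ricpq.
set u := ricE _ _ _ _; set v := (X in u = X).
set u' := ricE _ _ _ _; set v' := (X in _ <-> u' = X).
have E : u - v = ('X - e%:P) ^+ 2 * (u' - v').
  have sa' : s%:P * (s%:P - a%:P) = 0 :> {poly R} by rewrite -polyCB -polyCM sa.
  apply/eqP; rewrite -subr_eq0.
  rewrite [X in X == _](_ : _ = s%:P * (s%:P - a%:P) * (tau ^+ 2 * ('X - e%:P) * ('X + e%:P) * Q ^+ 2)).
    by rewrite sa' mul0r.
  by rewrite /u /v /u' /v' /ricE (jpE e2) /jeta !derivE; ring.
split=> /eqP; rewrite -subr_eq0.
  by rewrite E mulf_eq0 expf_eq0/= (negPf d0)/= subr_eq0 => /eqP.
by move=> /eqP h; apply/eqP; rewrite -subr_eq0 E h mulr0.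
Qed.

Lemma jetaN a b : jeta 1 a b = jeta (-1) b a.
Proof. by rewrite /jeta polyCN; ring. Qed.

(* (x - e) tau^2 times the conjugate of T_ng by (x - e)^s. *)
Definition gop tau e a b s y :=
  ('X - e%:P) * nop tau (jeta e a b - (2 * s)%:P * ('X + e%:P)) 1 y
  + ((s * (s - a))%:P * ('X + e%:P) - (s * (b + 1))%:P * ('X - e%:P)) * tau ^+ 2 * y.

(** With parameter [s], the polynomial [y] stands for [(x - e)^(-s) y / tau]; raising [s] by 1 and
    giving [y] a factor [x - e] leaves this function unchanged. *)
Lemma gop_shift tau e a b s y : e ^+ 2 = 1 ->
  gop tau e a b (s + 1) (('X - e%:P) * y) = ('X - e%:P) * gop tau e a b s y.
Proof.
move=> e2; rewrite /gop /nop (jpE e2) /jeta /dl !derivE; ring.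
Qed.

Lemma gop_shiftX tau e a b s k y : e ^+ 2 = 1 ->
  gop tau e a b (s + k%:R) (('X - e%:P) ^+ k * y) = ('X - e%:P) ^+ k * gop tau e a b s y.
Proof.
move=> e2; elim: k y => [|k IH] y; first by rewrite !expr0 !mul1r addr0.
by rewrite -natr1 addrA exprS -mulrA gop_shift // IH mulrA.
Qed.

Lemma gop0 tau e a b y : gop tau e a b 0 y = ('X - e%:P) * nop tau (jeta e a b) 1 y.
Proof. by rewrite /gop /nop /dl; ring. Qed.

(** At [s = a] the term in [s * (s - a)] drops out, so the conjugate is again of Jacobi form, with
    [- a] in place of [a] and a shift of the eigenvalue. *)
Lemma gop_end tau e a b y : gop tau e a b a y =
  ('X - e%:P) * (nop tau (jeta e (- a) b) 1 y - (a * (b + 1))%:P * tau ^+ 2 * y).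
Proof. rewrite /gop subrr mulr0 /jeta /nop /dl; ring. Qed.

(** Lagrange identity: the formal adjoint of [jp D^2 + h D] is [jp D^2 + (4x - h) D + 2 - h'], and
    the two sides differ by the derivative of a fraction over [tau^(c + c' + 1)]. *)
Lemma nop_adj tau h c c' y z :
  z * nop tau h c y - y * (nop tau (4 * 'X - h) c' z + (2 - h^`()) * tau ^+ 2 * z)
  = dl tau (c + c' + 1) (jp * (dl tau c y * z - y * dl tau c' z) + (h - 2 * 'X) * tau * y * z).
Proof.
by rewrite /nop /dl /jp !derivE /rpot /jp; ring.
Qed.

(** Division by [tau] intertwines the gauges: [T_ng] on [y] is [T_rg] on [y / tau], the case [c = 1]
    of [nop]. *)
Lemma nop_Tng tau al be y mu :
  tau != 0 -> Tng_eig tau al be y mu <-> nop tau (jeta 1 al be) 1 y = mu%:P * tau ^+ 2 * y.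
Proof.
move=> t0; rewrite /Tng_eig /eta_num -!mul_polyC.
rewrite (_ : tau^`(2) = tau^`()^`()) // (_ : y^`(2) = y^`()^`()) //.
set u := (X in X = _ <-> _); set v := (X in u = X).
have -> : nop tau (jeta 1 al be) 1 y = tau * u.
  by rewrite /u /nop /dl /jeta /rpot /jp !derivE; ring.
have -> : mu%:P * tau ^+ 2 * y = tau * v by rewrite /v; ring.
by split=> [->//|/mulfI]; apply.
Qed.

End Operator.

(** * Polynomials whose whole orbit under a divided operator stays polynomial *)

Section DivisionOrbit.
Variable R : realType.
Implicit Types (y z g p : {poly R}) (k : R).

Definition linpred (S : {poly R} -> Prop) :=
  forall k y z, S y -> S z -> S (k%:P * y + z).

Definition linop (A : {poly R} -> {poly R}) :=
  forall k y z, A (k%:P * y + z) = k%:P * A y + A z.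

Variables (A : {poly R} -> {poly R}) (G : {poly R}).
Hypothesis A_lin : linop A.

(** Euclidean division keeps [qop] total and linear even where [G] does not divide [A y], so
    [orbdiv] is a linear condition. *)
Definition qop y := A y %/ G.
Definition orbdiv y := forall j, G %| A (iter j qop y).

Lemma linop0 : A 0 = 0.
Proof. by have := A_lin (-1) 0 0; rewrite mulr0 addr0 polyCN mulN1r addNr. Qed.

Lemma qop_lin : linop qop.
Proof. by move=> k y z; rewrite /qop A_lin divpD !mul_polyC divpZl. Qed.

Lemma iter_qop_lin j : linop (iter j qop).
Proof. by elim: j => [|j IH] k y z //=; rewrite IH qop_lin. Qed.

Lemma orbdiv_lin : linpred orbdiv.
Proof.
move=> k y z hy hz j; rewrite iter_qop_lin A_lin.
by apply: dvdp_add; [apply: dvdp_mull; apply: hy | apply: hz].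
Qed.

Lemma orbdiv0 : orbdiv 0.
Proof.
move=> j; have := iter_qop_lin j (-1) 0 0.
by rewrite mulr0 addr0 polyCN mulN1r addNr => ->; rewrite linop0 dvdp0.
Qed.

Lemma orbdiv_qop y : orbdiv y -> orbdiv (qop y).
Proof. by move=> hy j; rewrite -iterSr; apply: hy. Qed.

Lemma orbdiv_eq y : orbdiv y -> A y = G * qop y.
Proof. by move=> /(_ 0%N)/= h; rewrite /qop mulrC divpK. Qed.

Lemma orbdiv_coind (S : {poly R} -> Prop) : G != 0 ->
  (forall y, S y -> exists2 z, S z & A y = G * z) -> forall y, S y -> orbdiv y.
Proof.
move=> G0 hS y Sy j.
suff /hS[z _ ->] : S (iter j qop y) by apply: dvdp_mulr.
elim: j => //= j /hS[z Sz e].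
by rewrite /qop e mulKp.
Qed.

Variable d : nat.
Definition rmap j (v : 'rV[R]_d) : 'rV[R]_(size G) :=
  poly_rV (A (iter j qop (rVpoly v)) %% G).

Lemma rmap_linear j : linear (rmap j).
Proof.
move=> k u v; rewrite /rmap linearP /= -mul_polyC iter_qop_lin A_lin modpD.
by rewrite mul_polyC modpZl linearP.
Qed.
HB.instance Definition _ j := GRing.isLinear.Build R _ _ _ (rmap j) (@rmap_linear j).

Fixpoint rker j : 'M[R]_d :=
  if j is j'.+1 then (rker j' :&: kermx (lin1_mx (rmap j')))%MS else 1%:M.

Lemma rker_mono i j : (i <= j)%N -> (rker j <= rker i)%MS.
Proof.
elim: j => [|j IH]; first by rewrite leqn0 => /eqP->.
rewrite leq_eqVlt => /orP[/eqP->//|]; rewrite ltnS => /IH; apply: submx_trans.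
by rewrite capmxSl.
Qed.

Lemma rkerP j (v : 'rV[R]_d) : G != 0 ->
  (v <= rker j)%MS <-> forall i, (i < j)%N -> G %| A (iter i qop (rVpoly v)).
Proof.
move=> G0; have E i : (v <= kermx (lin1_mx (rmap i)))%MS = (G %| A (iter i qop (rVpoly v))).
  rewrite sub_kermx mul_rV_lin1 /= /rmap /dvdp; apply/eqP/eqP => [|->].
    by move=> /(congr1 rVpoly); rewrite poly_rV_K ?linear0 // ltnW// ltn_modp.
  by rewrite linear0.
elim: j => [|j IH]; first by rewrite submx1; split.
rewrite /= sub_capmx E; split=> [/andP[/IH h1 h2] i|h].
  by rewrite ltnS leq_eqVlt => /orP[/eqP->//|/h1].
by rewrite h // andbT; apply/IH => i ij; apply: h; apply: ltnW.
Qed.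

(** On polynomials of size at most [d] the conditions cut out a decreasing chain of subspaces
    [rker j] of a finite-dimensional space; [J] is an index of least rank, after which the chain is
    constant. *)
Lemma orbdiv_stabilizes : G != 0 -> exists J, forall p, (size p <= d)%N ->
  (forall j, (j < J)%N -> G %| A (iter j qop p)) -> orbdiv p.
Proof.
move=> G0.
have ex : exists r, [exists j : 'I_r.+1, true] && `[< exists j, \rank (rker j) = r >].
  exists (\rank (rker 0)); apply/andP; split; first by apply/existsP; exists ord0.
  by apply/asboolP; exists 0%N.
case: (ex_minnP ex) => r /andP[_ /asboolP[J rJ]] rmin.
exists J => p sp hp j.
have [u pu] : exists u : 'rV[R]_d, p = rVpoly u by exists (poly_rV p); rewrite poly_rV_K.
have uJ : (u <= rker J)%MS by apply/rkerP => //; rewrite -pu.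
have : (u <= rker (maxn J j.+1))%MS.
  apply: (submx_trans uJ); have := rker_mono (leq_maxl J j.+1).
  move=> /mxrank_leqif_sup[le <-]; rewrite eqn_leq le /= rJ; apply: rmin.
  by apply/andP; split; [apply/existsP; exists ord0 | apply/asboolP; exists (maxn J j.+1)].
by move=> /rkerP-/(_ G0); rewrite -pu; apply; rewrite leq_maxr.
Qed.
End DivisionOrbit.

(** * An invariant space of finite codimension for an exceptional operator *)

Section Invariant.
Variable R : realType.
Implicit Types (tau h y z g p : {poly R}) (k a b e : R).

(** The second clause says that [T_ng] maps [S] to itself; the third gives [S] finite codimension
    and makes it contain a full ideal. *)
Definition invsub tau h (K : nat) (S : {poly R} -> Prop) :=
  [/\ linpred S,
      forall y, S y -> exists2 z, S z & nop tau h 1 y = tau ^+ 2 * z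
    & forall g, S (tau ^+ K * g)].

Definition hasinv tau h := exists K S, invsub tau h K S.

Lemma nop_lin tau h c : linop (nop tau h c).
Proof. by move=> k y z; rewrite nopD nopZ. Qed.

Lemma hasinv1 h : hasinv 1 h.
Proof.
exists 0%N, (fun=> True); split=> // y _; exists (nop 1 h 1 y) => //.
by rewrite expr1n mul1r.
Qed.

(** Eigenpolynomials have polynomial orbits and exist in every large degree, so leading terms can be
    removed one by one until a bounded degree is reached. *)
Lemma exceptional_reduce tau a b : tau != 0 -> exceptional tau a b ->
  exists d : nat, forall p : {poly R}, exists2 v : {poly R},
    orbdiv (nop tau (jeta 1 a b) 1) (tau ^+ 2) v & (size (p - v)%R <= d)%N.
Proof.
move=> t0 [_ [_ [s hs]]]; set U := orbdiv _ _.
have Ulin : linpred U by apply: orbdiv_lin; apply: nop_lin.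
exists (\max_(i <- s) i).+1 => p; set d := _.+1.
have ns n : (d <= n)%N -> n \notin s.
  by move=> dn; apply/negP => /(@leq_bigmax_seq _ _ xpredT id) /(_ isT) h;
     move: (leq_trans dn h); rewrite ltnn.
move: (leqnn (size p)); move: {2}(size p) => n; elim: n p => [|n IH] p sp.
  exists 0; last by rewrite subr0 (leq_trans sp).
  exact/orbdiv0/nop_lin.
have [nd|dn] := leqP n.+1 d.
  exists 0; last by rewrite subr0 (leq_trans sp).
  exact/orbdiv0/nop_lin.
have [y [mu [y0 [sy /(nop_Tng _ _ _ _ t0) hy]]]] := hs n (ns _ dn).
have Uy : U y.
  apply: (@orbdiv_coind _ _ _ (fun z => exists k, z = k%:P * y)); first by rewrite expf_neq0.
    move=> _ [k ->]; exists ((k * mu)%:P * y); first by exists (k * mu).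
    by rewrite nopZ hy; ring.
  by exists 1; rewrite mul1r.
pose k := p`_n / y`_n.
have yn : y`_n != 0 by rewrite -[n]/(n.+1.-1) -sy -lead_coefE lead_coef_eq0.
have [|v Uv sv] := IH (p - k%:P * y).
  apply/leq_sizeP => j; rewrite leq_eqVlt => /orP[/eqP<-|nj].
    by rewrite coefB coefCM /k divfK ?subrr.
  by rewrite coefB coefCM !nth_default ?mulr0 ?subr0 ?sy // (leq_trans sp).
exists (k%:P * y + v); first exact: Ulin.
by rewrite opprD addrA.
Qed.

Lemma exceptional_hasinv tau a b : tau != 0 -> exceptional tau a b ->
  hasinv tau (jeta 1 a b).
Proof.
move=> t0 /(exceptional_reduce t0)[d red].
have G0 : tau ^+ 2 != 0 by rewrite expf_neq0.
set A := nop tau (jeta 1 a b) 1; have Al : linop A by apply: nop_lin.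
have [J hJ] := orbdiv_stabilizes (A := A) Al d G0.
have AtX n g : A (tau ^+ n.+2 * g) = tau ^+ 2 * (tau ^+ n * nop tau (jeta 1 a b) (1 - n.+2%:R) g).
  by rewrite /A -[X in nop _ _ X](subrK n.+2%:R) nop_tauX mulrA -exprD.
(* One application of [T_ng] costs at most two powers of [tau], so a multiple of [tau ^+ J.*2]
   survives the [J] tests of [orbdiv_stabilizes]. *)
exists J.*2, (orbdiv A (tau ^+ 2)); split.
- exact: orbdiv_lin.
- by move=> y hy; exists (qop A (tau ^+ 2) y); [apply: orbdiv_qop | apply: orbdiv_eq].
move=> g.
have step j : (j <= J)%N -> exists g', iter j (qop A (tau ^+ 2)) (tau ^+ J.*2 * g) = tau ^+ (J - j).*2 * g'.
  elim: j => [_|j IH jJ]; first by exists g; rewrite subn0.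
  have [g' e] := IH (ltnW jJ); rewrite /= e.
  have -> : (J - j).*2 = (J - j.+1).*2.+2 by rewrite -doubleS -subSn.
  by eexists; rewrite /qop AtX mulKp.
(* Subtracting the stable [v] does not affect the [J] tests and leaves a polynomial of bounded
   size. *)
have [v Uv sv] := red (tau ^+ J.*2 * g).
rewrite -(subrK v (_ * g)) -[X in orbdiv _ _ (X + _)]mul1r -[1]/(1%:P).
apply: orbdiv_lin => //; apply: hJ => // j jJ.
rewrite -[X in iter j _ X]addr0.
have -> : tau ^+ J.*2 * g - v + 0 = (-1)%:P * v + tau ^+ J.*2 * g.
  by rewrite polyCN; ring.
rewrite iter_qop_lin // Al dvdp_addr; last by rewrite dvdp_mull // Uv.
have [g' ->] := step _ (ltnW jJ).
have -> : (J - j).*2 = (J - j.+1).*2.+2 by rewrite -doubleS -subSn.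
by rewrite AtX dvdp_mulr.
Qed.

End Invariant.

(** * Families of polynomials depending polynomially on a parameter *)

Section PolynomialFamilies.
Variable R : realType.
Implicit Types (F : R -> {poly R}) (phi : {poly R} -> {poly R}) (G : {poly R}).

Definition polyfun F := exists E : {poly {poly R}}, forall s, F s = E.[s%:P].

Lemma polyfun_const y : polyfun (fun=> y).
Proof. by exists y%:P => s; rewrite hornerC. Qed.

Lemma polyfun_add F1 F2 : polyfun F1 -> polyfun F2 -> polyfun (fun s => F1 s + F2 s).
Proof. by move=> [E1 h1] [E2 h2]; exists (E1 + E2) => s; rewrite hornerD h1 h2. Qed.

Lemma polyfun_scale F c : polyfun F -> polyfun (fun s => (s + c)%:P * F s).
Proof.
move=> [E h]; exists (('X + c%:P%:P) * E) => s.
by rewrite hornerM hornerD hornerX hornerC h polyCD.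
Qed.

Lemma polyfun_lin F phi : linop phi -> polyfun F -> polyfun (fun s => phi (F s)).
Proof.
move=> philin [E h]; exists (\poly_(i < size E) phi E`_i) => s.
rewrite h horner_poly horner_coef.
elim: (size E) => [|n IH]; first by rewrite !big_ord0 (linop0 philin).
rewrite !big_ord_recr /= -IH -!rmorphXn /= addrC [E`_n * _]mulrC philin addrC.
by rewrite [_ * phi _]mulrC.
Qed.

(** The remainder modulo [G] is again polynomial in the parameter; vanishing at infinitely many
    negative integers, it is zero. *)
Lemma polyfun_dvdp F G (J : nat) : polyfun F ->
  (forall k, (J <= k)%N -> G %| F (- k%:R)) -> forall s, G %| F s.
Proof.
move=> pF hF s.
have ml : linop (fun y => y %% G).
  by move=> k y z; rewrite modpD !mul_polyC modpZl.
have [E hE] := polyfun_lin ml pF.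
suff E0 : E = 0 by rewrite /dvdp hE E0 horner0.
apply: contraTeq isT => E0.
pose rs : seq {poly R} := [seq (- k%:R)%:P | k <- iota J (size E)].
have : (size rs < size E)%N.
  apply: max_poly_roots => //.
    apply/allP => _ /mapP[k + ->]; rewrite mem_iota => /andP[Jk _].
    by rewrite /root -hE; apply: hF.
  rewrite map_inj_in_uniq ?iota_uniq // => i j _ _ /polyC_inj /oppr_inj /eqP.
  by rewrite eqr_nat => /eqP.
by rewrite size_map size_iota ltnn.
Qed.
End PolynomialFamilies.

(** * The invariant space survives the sign change of a parameter *)

Section GaugeChange.
Variable R : realType.
Variables (tau : {poly R}) (e a b : R).
Hypotheses (e2 : e ^+ 2 = 1) (te : tau.[e] != 0).
Implicit Types (y z g p : {poly R}) (k s : R).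
Local Notation d := ('X - e%:P : {poly R}).

Lemma gop_polyfun (F : R -> {poly R}) c : polyfun F ->
  polyfun (fun s => gop tau e a b (s + c) (F s)).
Proof.
move=> pF.
pose g0 y := d * nop tau (jeta e a b) 1 y.
pose g1 y := - 2 * ('X + e%:P) * d * tau * dl tau 1 y
  - (a%:P * ('X + e%:P) + (b + 1)%:P * d) * tau ^+ 2 * y.
pose g2 y := ('X + e%:P) * tau ^+ 2 * y.
have l0 : linop g0 by move=> k y z; rewrite /g0 /nop /dl !derivE; ring.
have l1 : linop g1 by move=> k y z; rewrite /g1 /dl !derivE; ring.
have l2 : linop g2 by move=> k y z; rewrite /g2; ring.
have : polyfun (fun s => g0 (F s) + ((s + c)%:P * g1 (F s) + (s + c)%:P * ((s + c)%:P * g2 (F s)))).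
  apply: polyfun_add; first exact: (polyfun_lin l0).
  apply: polyfun_add; first exact/polyfun_scale/(polyfun_lin l1).
  exact/polyfun_scale/polyfun_scale/(polyfun_lin l2).
move=> [E hE]; exists E => s; rewrite -hE /gop /g0 /g1 /g2 /nop; ring.
Qed.

(** The factor [x - e] built into [gop] is absorbed by raising the gauge parameter by 1 at each
    step, so all iterates represent the orbit of one function. *)
Fixpoint gorb y j s : {poly R} :=
  if j is j'.+1 then gop tau e a b (s + j'%:R) (gorb y j' s) %/ tau ^+ 2 else y.

Lemma gorb_polyfun y j : polyfun (gorb y j).
Proof.
elim: j => [|j IH]; first exact: polyfun_const.
apply: (@polyfun_lin _ _ (fun y => y %/ tau ^+ 2)); last exact: gop_polyfun.
by move=> k z w; rewrite divpD !mul_polyC divpZl.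
Qed.

Lemma coprime_tau2 n : coprimep (tau ^+ 2) (d ^+ n).
Proof.
by rewrite coprimep_expl // coprimep_expr // coprimep_XsubC.
Qed.

(** For [s = - n] the gauge factor [(x - e)^n] is polynomial and the orbit is an orbit of [T_ng]
    inside [S]; coprimality of [tau] and [x - e] then strips that factor from the divisibility. *)
Lemma gorb_neg K S g n j : invsub tau (jeta e a b) K S -> (j <= n)%N ->
  S (d ^+ (n - j) * gorb (tau ^+ K * g) j (- n%:R)) /\
  ((j < n)%N -> tau ^+ 2 %| gop tau e a b (- n%:R + j%:R) (gorb (tau ^+ K * g) j (- n%:R))).
Proof.
move=> [Slin Sst SK]; have d0 : d != 0 by rewrite polyXsubC_eq0.
have key j' y : (j' < n)%N -> S (d ^+ (n - j') * y) ->
   exists2 z, S z & gop tau e a b (- n%:R + j'%:R) y * d ^+ (n - j'.+1) = tau ^+ 2 * z.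
  move=> jn /Sst[z Sz ez]; exists z => //; apply: (mulfI d0).
  have := gop_shiftX tau a b (- n%:R + j'%:R) (n - j') y e2.
  have -> : - n%:R + j'%:R + (n - j')%:R = 0 :> R by rewrite natrB 1?ltnW //; ring.
  by rewrite gop0 ez -(subnSK jn) => ->; rewrite exprS -[RHS]mulrA [X in _ = _ * X]mulrC.
have dv j' y : (j' < n)%N -> S (d ^+ (n - j') * y) ->
   tau ^+ 2 %| gop tau e a b (- n%:R + j'%:R) y.
  move=> jn /(key _ _ jn)[z _ ez].
  by rewrite -(Gauss_dvdpl _ (coprime_tau2 (n - j'.+1))) ez dvdp_mulr.
elim: j => [_|j IH jn].
  have S0 : S (d ^+ (n - 0) * gorb (tau ^+ K * g) 0 (- n%:R)) by rewrite /= mulrCA.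
  by split=> // n0; apply: dv.
have [Sj _] := IH (ltnW jn).
suff Sj1 : S (d ^+ (n - j.+1) * gorb (tau ^+ K * g) j.+1 (- n%:R)).
  by split=> // jn'; apply: dv.
have [z Sz ez] := key _ _ jn Sj.
rewrite [gorb _ _ _]/= divp_mulA ?dv // mulrC ez mulKp //.
by rewrite expf_neq0 //; apply: contraNneq te => ->; rewrite horner0.
Qed.

Lemma gorb_dvd K S g j s : invsub tau (jeta e a b) K S ->
  tau ^+ 2 %| gop tau e a b (s + j%:R) (gorb (tau ^+ K * g) j s).
Proof.
move=> inv; apply: (@polyfun_dvdp _ (fun s => gop tau e a b (s + j%:R) (gorb (tau ^+ K * g) j s)) _ j.+1).
  exact/gop_polyfun/gorb_polyfun.
by move=> k jk; apply: (gorb_neg g inv (ltnW jk)).2.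
Qed.

(** By [gorb_dvd] at [s = a] and [gop_end], multiples of [tau ^+ K] have polynomial orbits under the
    flipped operator shifted by a constant, and the shift does not affect invariance. *)
Lemma hasinv_flip : hasinv tau (jeta e a b) -> hasinv tau (jeta e (- a) b).
Proof.
move=> [K [S inv]]; have t0 : tau != 0 by apply: contraNneq te => ->; rewrite horner0.
pose A y := nop tau (jeta e (- a) b) 1 y - (a * (b + 1))%:P * tau ^+ 2 * y.
have Al : linop A by move=> k y z; rewrite /A nop_lin; ring.
exists K, (orbdiv A (tau ^+ 2)); split.
- exact: orbdiv_lin.
- move=> y hy; exists ((a * (b + 1))%:P * y + qop A (tau ^+ 2) y).
    by apply: orbdiv_lin => //; apply: orbdiv_qop.
  by have := orbdiv_eq hy; rewrite /A => /eqP; rewrite subr_eq => /eqP ->; ring.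
move=> g; set y := _ * g.
have dvA j : gorb y j a = d ^+ j * iter j (qop A (tau ^+ 2)) y -> tau ^+ 2 %| A (iter j (qop A (tau ^+ 2)) y).
  move=> ej; have := gorb_dvd g j a inv; rewrite -/y ej gop_shiftX // gop_end -/(A _) mulrA -exprSr.
  by rewrite Gauss_dvdpr // coprime_tau2.
have E j : gorb y j a = d ^+ j * iter j (qop A (tau ^+ 2)) y.
  elim: j => [|j IH]; first by rewrite mul1r.
  rewrite /= IH gop_shiftX // gop_end -/(A _) mulrA -exprSr -divp_mulA //.
  exact: dvA.
by move=> j; apply: dvA.
Qed.
End GaugeChange.

Lemma hasinv_flip1 (R : realType) (tau : {poly R}) (a b : R) : tau.[1] != 0 ->
  hasinv tau (jeta 1 a b) -> hasinv tau (jeta 1 (- a) b).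
Proof. by move=> t1; apply: hasinv_flip => //; rewrite expr1n. Qed.

Lemma hasinv_flip2 (R : realType) (tau : {poly R}) (a b : R) : tau.[-1] != 0 ->
  hasinv tau (jeta 1 a b) -> hasinv tau (jeta 1 a (- b)).
Proof. by move=> t1; rewrite !jetaN; apply: hasinv_flip => //; rewrite sqrrN expr1n. Qed.

(** * Calculus of top coefficients *)

Section TopCoefficient.
Variable R : realType.
Implicit Types (f g y z : {poly R}) (c d : R) (m n : nat).

(** Here [c] may be 0, so sums and products need no case distinction on cancellation. *)
Definition top f n c := (size f <= n.+1)%N /\ f`_n = c.

Lemma top_eq f n c m d : top f n c -> n = m -> c = d -> top f m d.
Proof. by move=> h <- <-. Qed.

Lemma top_lead f : f != 0 -> top f (size f).-1 (lead_coef f).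
Proof. by move=> f0; split; rewrite // prednK // size_poly_gt0. Qed.

Lemma topD f g n c d : top f n c -> top g n d -> top (f + g) n (c + d).
Proof.
move=> [sf <-] [sg <-]; split; last by rewrite coefD.
by rewrite (leq_trans (size_polyD _ _)) // geq_max sf.
Qed.

Lemma topN f n c : top f n c -> top (- f) n (- c).
Proof. by move=> [sf <-]; split; rewrite ?size_polyN ?coefN. Qed.

Lemma topB f g n c d : top f n c -> top g n d -> top (f - g) n (c - d).
Proof. by move=> hf /topN; apply: topD. Qed.

Lemma topM f g m n c d : top f m c -> top g n d -> top (f * g) (m + n) (c * d).
Proof.
move=> [sf <-] [sg <-]; split.
  by apply: (leq_trans (size_polyMleq _ _)); move: sf sg; lia.
have mo : (m < (m + n).+1)%N by rewrite ltnS leq_addr.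
rewrite coefM (bigD1 (Ordinal mo)) //= addKn big1 ?addr0 // => i; rewrite -val_eqE /= => im.
have [mi|im'] := ltnP m i; first by rewrite (nth_default _ (leq_trans sf mi)) mul0r.
by rewrite (@nth_default _ _ g) ?mulr0 // (leq_trans sg) //; lia.
Qed.

Lemma topC c : top c%:P 0 c.
Proof. by split; rewrite ?size_polyC_leq1 // coefC. Qed.

Lemma topX : top 'X 1 1.
Proof. by split; rewrite ?size_polyX // coefX. Qed.

Lemma top_Xderiv f n c : top f n c -> top ('X * f^`()) n (n%:R * c).
Proof.
move=> [sf <-]; split.
  apply/leq_sizeP => -[//|j] nj; rewrite coefXM /= coef_deriv nth_default ?mul0rn //.
  by rewrite (leq_trans sf).
by rewrite coefXM coef_deriv; case: n sf => [|n] _ /=; rewrite ?mul0r // mulr_natl.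
Qed.

Lemma top_mulX2 f n c : top ('X ^+ 2 * f) (2 + n) c -> top f n c.
Proof.
move=> [/leq_sizeP s <-]; split; last by rewrite coefXnM ltnNge leq_addr addKn.
by apply/leq_sizeP => j nj; have := s j.+2; rewrite coefXnM -[j.+2]/(2 + j)%N addKn; apply.
Qed.

Lemma top_mulI f g m n c d : c != 0 -> top f m c -> top (f * g) (m + n) (c * d) -> top g n d.
Proof.
move=> c0 tf tfg.
have f0 : f != 0 by apply: contraNneq c0 => f0; rewrite -tf.2 f0 coef0.
have sf : size f = m.+1.
  apply/eqP; rewrite eqn_leq tf.1 ltnNge; apply: contraNN c0 => s.
  by rewrite -tf.2 nth_default.
have sg : (size g <= n.+1)%N.
  have [->|g0] := eqVneq g 0; first by rewrite size_poly0.
  by have := tfg.1; rewrite size_mul // sf addSn /= -addnS leq_add2l.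
split=> //; apply: (mulfI c0); rewrite -tfg.2.
by have [_ ->] : top (f * g) (m + n) (c * g`_n) by apply: topM.
Qed.

Lemma top0_size f n : top f n 0 -> (size f <= n)%N.
Proof.
move=> [s f0]; apply/leq_sizeP => j; rewrite leq_eqVlt => /orP[/eqP<-//|nj].
by rewrite nth_default // (leq_trans s).
Qed.
End TopCoefficient.

(** * The operator on the degree filtration of the invariant space *)

Section DegreeFiltration.
Variable R : realType.
Variables (tau h : {poly R}).
Hypotheses (tau0 : tau != 0) (sh : (size h <= 2)%N).
Implicit Types (f g y z u v : {poly R}) (c d lam k : R) (m n : nat).
Local Notation N := (size tau).-1.
Local Notation t := (lead_coef tau).

(* indicial polynomial at infinity of the operator acting on y / tau^k *)
Definition chi k n : R := (n%:R - k * N%:R) * (n%:R - k * N%:R - 1 + h`_1).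

Lemma top_jp : top (jp R) 2 1.
Proof.
rewrite /jp; split; last by rewrite coefB coefXn coef1 subr0.
by rewrite (leq_trans (size_polyD _ _)) // size_polyXn size_polyN size_poly1.
Qed.

Lemma top_nop0 k y n c : top y n c -> top (nop tau h k y) (n + N.*2) (chi k n * t ^+ 2 * c).
Proof.
move=> ty; have tt := top_lead tau0; have tX := topX R.
(* Multiplying each derivative by ['X] yields an Euler operator, which preserves the degree; the
   resulting ['X ^+ 2] is removed by [top_mulX2]. *)
have dlE (k' : R) g : 'X * dl tau k' g = tau * ('X * g^`()) - k'%:P * (('X * tau^`()) * g).
  by rewrite /dl; ring.
have dl2E (k' : R) g : 'X ^+ 2 * dl tau k' g =
   tau * ('X * ('X * g)^`() - 'X * g) - k'%:P * (('X * tau^`()) * ('X * g)).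
  by rewrite /dl !derivE; ring.
have td := topB (topM tt (top_Xderiv ty)) (topM (topC k) (topM (top_Xderiv tt) ty)).
rewrite -dlE in td.
have tdd := topB (topM tt (topB (top_Xderiv td) td))
                 (topM (topC (k + 1)) (topM (top_Xderiv tt) td)).
rewrite -dl2E in tdd.
have th : top h 1 h`_1 by [].
have tr := topM (topC 2) (topD (topM top_jp (topB (topM (topB (top_Xderiv (top_Xderiv tt)) (top_Xderiv tt)) tt)
   (topM (top_Xderiv tt) (top_Xderiv tt)))) (topM (topM tX tX) (topM (top_Xderiv tt) tt))).
rewrite (_ : _ * _ = 'X ^+ 2 * rpot tau) in tr; last first.
  by rewrite /rpot -[2%:P]/(2%:R%:P) polyC_natr !derivE; ring.
apply: top_mulX2.
have -> : 'X ^+ 2 * nop tau h k y = jp R * ('X ^+ 2 * dl tau (k + 1) (dl tau k y))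
   + 'X * h * tau * ('X * dl tau k y) + 'X ^+ 2 * rpot tau * y.
  by rewrite /nop; ring.
have {}tr := topM tr ty; have {}td := topM (topM (topM tX th) tt) td.
have {}tdd := topM top_jp tdd.
have e1 : (2 + (N + (N + n)) = 2 + (n + N.*2))%N by lia.
have e2 : (1 + 1 + N + (N + n) = 2 + (n + N.*2))%N by lia.
have e3 : (0 + (2 + (N + N)) + n = 2 + (n + N.*2))%N by lia.
rewrite e1 in tdd; rewrite e2 in td; rewrite e3 in tr.
apply: (top_eq (topD (topD tdd td) tr)) => //.
by rewrite /chi natrD; ring.
Qed.

Lemma top_nop k lam y n c : top y n c ->
  top (nop tau h k y - lam%:P * tau ^+ 2 * y) (n + N.*2) ((chi k n - lam) * t ^+ 2 * c).
Proof.
move=> ty; have tt := top_lead tau0.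
have tl : top (lam%:P * tau ^+ 2 * y) (n + N.*2) (lam * t ^+ 2 * c).
  apply: (top_eq (topM (topM (topC lam) (topM tt tt)) ty)); last by rewrite expr2.
  by rewrite add0n addnn addnC.
by apply: (top_eq (topB (top_nop0 k ty) tl)) => //; ring.
Qed.

Lemma nop_size k lam y n : (size y <= n)%N ->
  (size (nop tau h k y - lam%:P * tau ^+ 2 * y)%R <= n + N.*2)%N.
Proof.
case: n => [|n] sy.
  by move: sy; rewrite size_poly_leq0 => /eqP->; rewrite nop0 mulr0 subrr size_poly0.
by have [] := @top_nop k lam y n y`_n (conj sy erefl).
Qed.

Lemma eig_chi k lam y : y != 0 -> nop tau h k y = lam%:P * tau ^+ 2 * y ->
  lam = chi k (size y).-1.
Proof.
move=> y0 e; have := (top_nop k lam (top_lead y0)).2.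
have nz : t ^+ 2 * lead_coef y != 0 by rewrite mulf_neq0 ?expf_neq0 ?lead_coef_eq0.
rewrite e subrr coef0 => /esym/eqP; rewrite -mulrA mulf_eq0 (negPf nz) orbF subr_eq0.
by move=> /eqP.
Qed.

Variables (K : nat) (S : {poly R} -> Prop).
Hypothesis inv : invsub tau h K S.

Lemma inv0 : S 0.
Proof. by case: inv => _ _ /(_ 0); rewrite mulr0. Qed.

Lemma invZ k y : S y -> S (k%:P * y).
Proof. by case: inv => l _ _ Sy; rewrite -[_ * y]addr0; apply: l => //; apply: inv0. Qed.

Lemma invB y z : S y -> S z -> S (y - z).
Proof.
case: inv => l _ _ Sy Sz; have -> : y - z = (-1)%:P * z + y by ring.
exact: l.
Qed.

Lemma inv_image lam y : S y ->
  exists2 u, S u & nop tau h 1 y - lam%:P * tau ^+ 2 * y = tau ^+ 2 * u.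
Proof.
move=> Sy; have [_ /(_ y Sy)[z Sz ->] _] := inv.
by exists (z - lam%:P * y); [apply/invB/invZ | ring].
Qed.

Lemma image_top lam y u n c : top y n c ->
  nop tau h 1 y - lam%:P * tau ^+ 2 * y = tau ^+ 2 * u -> top u n ((chi 1 n - lam) * c).
Proof.
move=> /(top_nop 1 lam) ty e; rewrite e in ty.
have t20 : t ^+ 2 != 0 by rewrite expf_neq0 // lead_coef_eq0.
have tt2 : top (tau ^+ 2) (N + N) (t ^+ 2) by rewrite !expr2; apply: topM; apply: top_lead.
apply: (top_mulI t20 tt2); apply: (top_eq ty); last by ring.
by rewrite addnn addnC.
Qed.

(* Degree by degree: an element of degree n either has an image of degree n,
   or (when chi 1 n = lam) its image is already attained in smaller degree,
   which produces a kernel element. *)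
Lemma inv_surj lam :
  (forall y, S y -> nop tau h 1 y = lam%:P * tau ^+ 2 * y -> y = 0) ->
  forall n u, S u -> (size u <= n)%N ->
  exists v, [/\ S v, (size v <= n)%N & nop tau h 1 v - lam%:P * tau ^+ 2 * v = tau ^+ 2 * u].
Proof.
move=> inj; elim=> [|n IH] u Su su.
  move: su; rewrite size_poly_leq0 => /eqP->; exists 0.
  by split; rewrite ?size_poly0 //; [apply: inv0 | rewrite nop0 !mulr0 subrr].
have [[v [Sv sv]]|nov] := pselect (exists v, S v /\ size v = n.+1); last first.
  have [|v [Sv sv ev]] := IH u Su.
    by move: su; rewrite leq_eqVlt ltnS => /orP[/eqP su|//]; case: nov; exists u.
  by exists v; split=> //; apply: leqW.
have v0 : v != 0 by rewrite -size_poly_eq0 sv.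
have [w Sw ew] := inv_image lam Sv.
have tv : top v n (lead_coef v) by have := top_lead v0; rewrite sv.
have tw := image_top tv ew.
have [ec|nc] := eqVneq (chi 1 n - lam) 0.
  rewrite ec mul0r in tw; have [v1 [Sv1 sv1 ev1]] := IH w Sw (top0_size tw).
  have vv1 : v = v1.
    apply/eqP; rewrite -subr_eq0; apply/eqP/inj; first exact: invB.
    by apply/eqP; rewrite -subr_eq0 nopB; apply/eqP; move: ew; rewrite -ev1 => ew;
       rewrite -[RHS](subrr (nop tau h 1 v - lam%:P * tau ^+ 2 * v)) [X in _ = _ - X]ew; ring.
  by move: sv1; rewrite -vv1 sv ltnn.
(* This multiple of the image of [v] cancels the degree [n] term of [u]. *)
pose k := u`_n / ((chi 1 n - lam) * lead_coef v).
have d0 : (chi 1 n - lam) * lead_coef v != 0 by rewrite mulf_neq0 ?lead_coef_eq0.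
have tu : top (u - k%:P * w) n 0.
  apply: (top_eq (topB (conj su erefl) (topM (topC k) tw))) => //.
  by rewrite /k divfK ?subrr.
have [v1 [Sv1 sv1 ev1]] := IH (u - k%:P * w) (invB Su (invZ k Sw)) (top0_size tu).
exists (k%:P * v + v1); split.
- by case: inv => l _ _; apply: l.
- rewrite (leq_trans (size_polyD _ _)) // geq_max mul_polyC (leqW sv1).
  by rewrite (leq_trans (size_scale_leq _ _)) ?sv.
rewrite nopD nopZ; transitivity (k%:P * (nop tau h 1 v - lam%:P * tau ^+ 2 * v)
  + (nop tau h 1 v1 - lam%:P * tau ^+ 2 * v1)); first by ring.
by rewrite ew ev1; ring.
Qed.

(** The image of [v] drops in degree. Were the operator injective on [S], that image would be
    attained by some [v1] of smaller degree, and [v - v1] would be a nonzero kernel element. *)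
Lemma inv_kernel lam v n : S v -> size v = n.+1 -> chi 1 n = lam ->
  exists y, [/\ S y, y != 0 & nop tau h 1 y = lam%:P * tau ^+ 2 * y].
Proof.
move=> Sv sv ec; have v0 : v != 0 by rewrite -size_poly_eq0 sv.
have [//|nex] := pselect (exists y, [/\ S y, y != 0 & nop tau h 1 y = lam%:P * tau ^+ 2 * y]).
have inj y : S y -> nop tau h 1 y = lam%:P * tau ^+ 2 * y -> y = 0.
  by move=> Sy ey; apply/eqP/negPn/negP => y0; apply: nex; exists y.
have [w Sw ew] := inv_image lam Sv.
have tv : top v n (lead_coef v) by have := top_lead v0; rewrite sv.
have := image_top tv ew; rewrite ec subrr mul0r => /top0_size sw.
have [v1 [Sv1 sv1 ev1]] := inv_surj inj Sw sw.
suff vv1 : v = v1 by move: sv1; rewrite -vv1 sv ltnn.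
apply/eqP; rewrite -subr_eq0; apply/eqP/inj; first exact: invB.
rewrite -ev1 in ew; rewrite nopB.
by rewrite -[LHS](subrK (nop tau h 1 v - lam%:P * tau ^+ 2 * v)) [X in _ + X]ew; ring.
Qed.

(** The ideal generated by [tau ^+ K] contains an element of each degree [n >= K * N], to which
    [inv_kernel] applies. *)
Lemma inv_eigenpoly n : (K * N <= n)%N ->
  exists y, [/\ S y, y != 0 & nop tau h 1 y = (chi 1 n)%:P * tau ^+ 2 * y].
Proof.
move=> Kn; apply: (@inv_kernel _ (tau ^+ K * 'X^(n - K * N))) => //.
  by case: inv => _ _.
have sK : size (tau ^+ K) = (K * N).+1.
  by rewrite -[LHS]prednK ?size_exp ?size_poly_gt0 ?expf_neq0 // mulnC.
by rewrite size_mulXn ?expf_neq0 // sK addnS subnK.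
Qed.
End DegreeFiltration.

(** * Irreducible factors over the reals *)

Section Irreducible.
Variable R : realType.
Implicit Types (f g p q P Q : {poly R}).

Lemma irredp_coprime q f : irreducible_poly q -> coprimep q f = ~~ (q %| f).
Proof.
move=> irr; apply/idP/idP => [|nd].
  apply: contraTN => /dvdpP[g ->].
  rewrite coprimep_sym coprimepMl coprimepp.
  by have := irr.1; case: (size q) => [|[|n]] // _; rewrite andbF.
apply/coprimepP => g /(irredp_XsubCP irr)[//|gq gf].
by move: nd; rewrite -(eqp_dvdl _ gq) gf.
Qed.

Lemma irredp_prime q f g : irreducible_poly q -> (q %| f * g) = (q %| f) || (q %| g).
Proof.
move=> irr; have [qf|qf] := boolP (q %| f); first by rewrite dvdp_mulr.
by rewrite Gauss_dvdpr // irredp_coprime.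
Qed.

Lemma irredp_primeX q f n : irreducible_poly q -> (0 < n)%N -> (q %| f ^+ n) = (q %| f).
Proof.
case: n => // n irr _; elim: n => [|n IH]; first by rewrite expr1.
by rewrite exprS irredp_prime // IH orbb.
Qed.

Lemma irredp_factor p : (1 < size p)%N -> exists2 q, irreducible_poly q & q %| p.
Proof.
move: {2}(size p) (leqnn (size p)) => n; elim: n p => [|n IH] p sp p1.
  by move: p1; rewrite ltnNge (leq_trans sp).
have [irr|] := pselect (irreducible_poly p); first by exists p.
move=> nirr; have [q [q1 qp qnp]] : exists q, [/\ size q != 1, q %| p & ~~ (q %= p)].
  apply: contrapT => h; apply: nirr; split=> // q q1 qp.
  by apply/negPn/negP => qnp; apply: h; exists q.
have p0 : p != 0 by rewrite -size_poly_gt0 ltnW.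
have q0 : q != 0 by apply: contraTneq qp => ->; rewrite dvd0p.
have sq : (size q < size p)%N.
  by rewrite ltn_neqAle dvdp_leq // andbT dvdp_size_eqp.
have [|| r irr rq] := IH q; first by rewrite -ltnS (leq_trans sq).
  by rewrite ltn_neqAle eq_sym q1 size_poly_gt0.
by exists r => //; apply: dvdp_trans qp.
Qed.

Lemma irredp_deriv q : irreducible_poly q -> ~~ (q %| q^`()).
Proof.
move=> irr; have q0 := irredp_neq0 irr.
have d0 : q^`() != 0.
  apply/negP => /eqP/(congr1 (fun p : {poly R} => p`_(size q).-2)).
  rewrite coef_deriv coef0 => /eqP; rewrite mulrn_eq0; have := irr.1.
  case E : (size q) => [|[|n]] // _; rewrite /= -[n.+1]/(n.+2.-1) -E -lead_coefE.
  by rewrite lead_coef_eq0 (negPf q0).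
by apply/negP => /(dvdp_leq d0); rewrite leqNgt lt_size_deriv.
Qed.

Lemma polyC_ndvd q (c : R) : irreducible_poly q -> c != 0 -> ~~ (q %| c%:P).
Proof.
move=> irr c0; apply/negP => /(dvdp_leq _); rewrite polyC_eq0 c0 size_polyC c0 => /(_ isT).
by rewrite leqNgt irr.1.
Qed.

Lemma irredp_factorX q f : irreducible_poly q -> f != 0 ->
  exists n g, f = q ^+ n * g /\ ~~ (q %| g).
Proof.
move=> irr; move: {2}(size f) (leqnn (size f)) => n; elim: n f => [|n IH] f sf f0.
  by move: sf; rewrite size_poly_leq0 (negPf f0).
have [/dvdpP[g fE]|nd] := boolP (q %| f); last by exists 0%N, f; rewrite mul1r.
have g0 : g != 0 by apply: contraNneq f0 => g0; rewrite fE g0 mul0r.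
have sg : (size g <= n)%N.
  move: sf; rewrite fE size_mul ?(irredp_neq0 irr) //; have := irr.1.
  by move: (size g) (size q) => a b; lia.
have [m [k [gE qk]]] := IH g sg g0.
by exists m.+1, k; split=> //; rewrite fE gE exprSr; ring.
Qed.

Lemma mulp_derivX q n : q * (q ^+ n)^`() = n%:R * q^`() * q ^+ n.
Proof.
elim: n => [|n IH]; first by rewrite expr0 derivC mulr0 !mul0r.
rewrite exprS derivM mulrDr mulrCA IH -natr1; ring.
Qed.
End Irreducible.

(** * Lowest-order terms of the operator at a factor of [tau] *)

Section LocalExponents.
Variable R : realType.
Implicit Types (tau sg h f g q y P Q r : {poly R}) (c lam e : R).

Lemma dl_local q sg kap j r c :
  q * dl (q ^+ kap * sg) c (q ^+ j * r) =
  q ^+ (kap + j) * ((j%:R - c * kap%:R)%:P * q^`() * sg * r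
     + q * (sg * r^`() - c%:P * sg^`() * r)).
Proof.
transitivity (q ^+ kap * sg * (q * (q ^+ j)^`() * r + q * q ^+ j * r^`())
  - c%:P * (q * (q ^+ kap)^`() * sg + q * q ^+ kap * sg^`()) * (q ^+ j * r)).
  by rewrite /dl !derivM; ring.
rewrite !mulp_derivX exprD polyCB polyCM !polyC_natr; ring.
Qed.

(** With [v] defined by [q * (q ^+ kap * sg)' = q ^+ kap * v], this is [rpot] with its powers of [q]
    removed, as in [rpot_local]. *)
Definition rloc q sg (kap : nat) : {poly R} :=
  let v := kap%:R * q^`() * sg + q * sg^`() in
  2 * (jp R * (sg * (kap%:R * q^`() * v + q * v^`() - q^`() * v) - v ^+ 2) + 'X * q * sg * v).

Lemma rpot_local q sg kap : q ^+ 2 * rpot (q ^+ kap * sg) = q ^+ kap.*2 * rloc q sg kap.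
Proof.
set v := kap%:R * q^`() * sg + q * sg^`().
have e1 : q * (q ^+ kap * sg)^`() = q ^+ kap * v.
  transitivity (q * (q ^+ kap)^`() * sg + q * q ^+ kap * sg^`()).
    by rewrite derivM; ring.
  by rewrite mulp_derivX /v; ring.
have e2 : q ^+ 2 * (q ^+ kap * sg)^`()^`() = q ^+ kap * (kap%:R * q^`() * v + q * v^`() - q^`() * v).
  transitivity (q * (q * (q ^+ kap * sg)^`())^`() - q^`() * (q * (q ^+ kap * sg)^`())).
    by set w := (q ^+ kap * sg)^`(); rewrite derivM; ring.
  rewrite e1 derivM; transitivity ((q * (q ^+ kap)^`()) * v + q * q ^+ kap * v^`() - q^`() * (q ^+ kap * v)).
    by ring.
  by rewrite mulp_derivX; ring.
rewrite /rpot; move: e1 e2; set t1 := _^`(); set t2 := _^`() => e1 e2.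
transitivity (2 * (jp R * ((q ^+ 2 * t2) * (q ^+ kap * sg) - (q * t1) ^+ 2) + 'X * q * (q * t1) * (q ^+ kap * sg))).
  by ring.
by rewrite e1 e2 -addnn exprD /rloc -/v; ring.
Qed.

(* The indicial polynomial at q of multiplicity kap in tau is s (s - 1) - 2 kap. *)
Lemma nop_local q sg h kap i f : exists E,
  q ^+ 2 * nop (q ^+ kap * sg) h 1 (q ^+ i * f) =
  q ^+ (kap.*2 + i) * (((i%:R - kap%:R) * (i%:R - kap%:R - 1) - 2 * kap%:R)%:P
     * (jp R * q^`() ^+ 2 * sg ^+ 2 * f) + q * E).
Proof.
set tau := _ * sg.
set x := (i%:R - kap%:R : R).
pose r := (i%:R - 1 * kap%:R)%:P * q^`() * sg * f + q * (sg * f^`() - 1%:P * sg^`() * f).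
pose g := dl tau 1 (q ^+ i * f).
have eg : q * g = q ^+ (kap + i) * r by rewrite /g dl_local.
have edg : q * dl tau (1 + 1) (q * g) = q ^+ (kap + (kap + i)) *
    (((kap + i)%:R - (1 + 1) * kap%:R)%:P * q^`() * sg * r
     + q * (sg * r^`() - (1 + 1)%:P * sg^`() * r)).
  by rewrite eg dl_local.
have e2 : q ^+ 2 * dl tau (1 + 1) g = q ^+ (kap + (kap + i)) *
    ((x - 1)%:P * q^`() * sg * r + q * (sg * r^`() - 2%:P * sg^`() * r)).
  transitivity (q * dl tau (1 + 1) (q * g) - tau * q^`() * (q * g)).
    by rewrite {1 2}/dl derivM; ring.
  rewrite edg eg /tau !exprD.
  have -> : ((kap + i)%:R - (1 + 1) * kap%:R : R) = x by rewrite /x; ring.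
  clear edg eg g; clearbody r x; ring.
pose v1 := sg^`().
pose v := kap%:R * q^`() * sg + q * v1.
exists (jp R * ((x - 1)%:P * q^`() * sg * (sg * f^`() - sg^`() * f) + (sg * r^`() - 2%:P * sg^`() * r))
  + h * sg * r
  + 2 * (jp R * (sg * ((kap%:R - 1) * q^`() * v1 + v^`()) - 2 * kap%:R * q^`() * sg * v1 - q * v1 ^+ 2)
     + 'X * sg * v) * f).
transitivity (jp R * (q ^+ 2 * dl tau (1 + 1) g) + h * tau * q * (q * g) + q ^+ 2 * rpot tau * (q ^+ i * f)).
  by rewrite /nop -/g; ring.
rewrite e2 eg rpot_local {1}/tau /rloc -/v1 -/v; set v' := v^`(); set r' := r^`().
have -> : (x * (x - 1) - 2 * kap%:R)%:P = x%:P * (x%:P - 1) - 2 * kap%:R :> {poly R} by ring.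
have -> : (x - 1)%:P = x%:P - 1 :> {poly R} by ring.
have rE : r = x%:P * q^`() * sg * f + q * (sg * f^`() - sg^`() * f).
  by rewrite /r /x; ring.
rewrite rE /v -/v1 -addnn !exprD; clearbody x v' r' v1; ring.
Qed.
End LocalExponents.

(** * Integer exponents and residues of Riccati solutions *)

Section RiccatiLocal.
Variable R : realType.
Implicit Types (tau sg h f g q y P Q r : {poly R}) (c lam e a b : R).

(* The operator lowers the q-order by exactly 2 unless the order is a local
   exponent; orders cannot decrease for ever, so some exponent is an integer. *)
Lemma integral_exponent tau h K S q kap sg :
  invsub tau h K S -> irreducible_poly q -> tau = q ^+ kap * sg -> ~~ (q %| sg) ->
  ~~ (q %| jp R) -> exists z : int, z * (z - 1) = 2 * kap%:Z.
Proof.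
move=> [_ Sst SK] irr tauE qsg qjp; have q0 := irredp_neq0 irr.
have key i : forall f, ~~ (q %| f) -> S (q ^+ i * f) -> exists z : int, z * (z - 1) = 2 * kap%:Z.
  elim/ltn_ind: i => i IH f qf Sf.
  have [u Su eu] := Sst _ Sf; rewrite tauE in eu.
  have [E eE] := nop_local q sg h kap i f.
  rewrite eu in eE; move: eE; set x := (X in X%:P * _); set W := _ + q * E => eE.
  have {}eE : q ^+ 2 * (sg ^+ 2 * u) = q ^+ i * W.
    apply: (@mulfI _ (q ^+ kap.*2)); first by rewrite expf_neq0.
    by rewrite [RHS]mulrA -exprD -eE -muln2 exprM; ring.
  (* A zero of the indicial polynomial makes [i - kap] the integer sought. *)
  have [x0|x0] := eqVneq x 0.
    exists (i%:Z - kap%:Z); apply/eqP; rewrite -subr_eq0 -(intr_eq0 R).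
    rewrite -[X in _ == X]x0 /x; apply/eqP.
    by rewrite !pmulrn; ring.
  have qW : ~~ (q %| W).
    rewrite /W dvdp_addl; last exact: dvdp_mulIl.
    rewrite !irredp_prime // ?irredp_primeX //.
    rewrite !negb_or; rewrite qjp qsg qf irredp_deriv // polyC_ndvd //.
  have [i2|i2] := ltnP i 2.
    have : q ^+ (2 - i) * (sg ^+ 2 * u) = W.
      by apply: (@mulfI _ (q ^+ i)); rewrite ?expf_neq0 // [LHS]mulrA -exprD subnKC 1?ltnW.
    by move=> WE; move: qW; rewrite -WE dvdp_mulr // irredp_primeX ?subn_gt0.
  have eW : sg ^+ 2 * u = q ^+ (i - 2) * W.
    by apply: (@mulfI _ (q ^+ 2)); rewrite ?expf_neq0 // eE [RHS]mulrA -exprD subnKC.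
  have : q ^+ (i - 2) %| u.
    rewrite -(@Gauss_dvdpr _ _ (sg ^+ 2)) ?eW ?dvdp_mulr //.
    by rewrite coprimep_expl // coprimep_expr // irredp_coprime.
  move=> /dvdpP[v vE]; rewrite mulrC in vE.
  apply: (IH (i - 2)%N _ v); [by lia | | by rewrite -vE].
  have WE : sg ^+ 2 * v = W.
    by apply: (@mulfI _ (q ^+ (i - 2))); rewrite ?expf_neq0 // -eW vE; ring.
  by apply: contraNN qW => qv; rewrite -WE dvdp_mull.
(* The descent starts from [tau ^+ K], which lies in [S]. *)
apply: (key (kap * K)%N (sg ^+ K)).
  by case: (K) => [|n]; [rewrite expr0 polyC_ndvd ?oner_neq0 | rewrite irredp_primeX].
by have := SK 1; rewrite tauE mulr1 exprMn exprM.
Qed.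

(** The pole at [q] is simple, since otherwise [P ^+ 2] would be the only term of lowest order. Its
    residue then solves [x * (x - 1) = 2 * kap] modulo [q], whose roots are [z] and [1 - z]. *)
Lemma ric_local tau h lam P Q q kap sg (z : int) :
  irreducible_poly q -> tau = q ^+ kap * sg -> ~~ (q %| sg) -> ~~ (q %| jp R) ->
  z * (z - 1) = 2 * kap%:Z -> coprimep P Q -> q %| Q -> Q != 0 -> ricpq tau h lam P Q ->
  exists Q1, [/\ Q = q * Q1, ~~ (q %| Q1) &
    (q %| P - z%:~R%:P * q^`() * Q1) \/ (q %| P - (1 - z)%:~R%:P * q^`() * Q1)].
Proof.
move=> irr tauE qsg qjp ez co qQ Q0 ric; have q0 := irredp_neq0 irr.
have qP : ~~ (q %| P).
  by rewrite -irredp_coprime // coprimep_sym; apply: coprimep_dvdl qQ co.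
have {}ric : q ^+ 2 * sg ^+ 2 * jp R * (P^`() * Q - P * Q^`() + P ^+ 2)
    + q ^+ 2 * sg ^+ 2 * h * P * Q + rloc q sg kap * Q ^+ 2
    = lam%:P * (q ^+ 2 * sg ^+ 2 * Q ^+ 2).
  apply: (@mulfI _ (q ^+ kap.*2)); first by rewrite expf_neq0.
  move: ric; rewrite /ricpq /ricE => /(congr1 (fun p => q ^+ 2 * p)) ric.
  rewrite mulrDr [_ * (rloc _ _ _ * _)]mulrA -rpot_local -tauE.
  have tt : tau ^+ 2 = q ^+ kap.*2 * sg ^+ 2 by rewrite tauE exprMn -exprM muln2.
  rewrite tt in ric; transitivity (q ^+ 2 * (lam%:P * (q ^+ kap.*2 * sg ^+ 2 * Q ^+ 2))).
    by rewrite -ric; ring.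
  by ring.
have /dvdpP[Q1 QE] := qQ; rewrite mulrC in QE.
have qQ1 : ~~ (q %| Q1).
  apply/negP => /dvdpP[Q2 Q1E].
  have : q %| sg ^+ 2 * jp R * P ^+ 2.
    apply/dvdpP; exists (lam%:P * sg ^+ 2 * q ^+ 3 * Q2 ^+ 2 - sg ^+ 2 * jp R * P^`() * q * Q2
      + sg ^+ 2 * jp R * P * (2 * q^`() * Q2 + q * Q2^`()) - sg ^+ 2 * h * P * q * Q2
      - rloc q sg kap * q * Q2 ^+ 2).
    apply: (@mulfI _ (q ^+ 2)); first by rewrite expf_neq0.
    apply/eqP; rewrite -subr_eq0; apply/eqP.
    move: ric => /eqP; rewrite -subr_eq0 => /eqP ric; rewrite -[RHS]ric QE Q1E !derivM; ring.
  by rewrite !irredp_prime // ?irredp_primeX // (negPf qsg) (negPf qjp) (negPf qP).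
exists Q1; split=> //; apply/orP; rewrite -irredp_prime //.
set zz := z%:~R%:P.
have zE : zz * (zz - 1) - 2 * kap%:R = 0.
  have -> : zz * (zz - 1) = (z * (z - 1))%:~R%:P.
    by rewrite intrM intrB polyCM polyCB.
  have -> : (z * (z - 1))%:~R = 2 * kap%:R :> R by rewrite ez intrM.
  by ring.
have -> : (1 - z)%:~R%:P = 1 - zz by rewrite intrB polyCB.
suff : q %| (sg ^+ 2 * jp R) * ((P - zz * q^`() * Q1) * (P - (1 - zz) * q^`() * Q1)).
  by rewrite irredp_prime // irredp_prime // ?irredp_primeX // (negPf qsg) (negPf qjp).
pose v := kap%:R * q^`() * sg + q * sg^`().
pose E2 := 2 * (jp R * (sg * ((kap%:R - 1) * q^`() * sg^`() + v^`()) - 2 * kap%:R * q^`() * sg * sg^`()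
   - q * sg^`() ^+ 2) + 'X * sg * v).
apply/dvdpP; exists (lam%:P * sg ^+ 2 * q * Q1 ^+ 2 - sg ^+ 2 * jp R * (P^`() * Q1 - P * Q1^`())
   - sg ^+ 2 * h * P * Q1 - E2 * Q1 ^+ 2).
apply: (@mulfI _ (q ^+ 2)); first by rewrite expf_neq0.
apply/eqP; rewrite -subr_eq0; apply/eqP.
move: ric => /eqP; rewrite -subr_eq0 => /eqP; set D := (X in X = 0) => D0.
transitivity (D - q ^+ 2 * sg ^+ 2 * jp R * q^`() ^+ 2 * Q1 ^+ 2 * (zz * (zz - 1) - 2 * kap%:R)).
  rewrite /D QE derivM /rloc /E2 -/v; set v' := v^`(); rewrite /v; ring.
by rewrite D0 zE mulr0 subr0.
Qed.

(** The leading terms at [e] give [x * (x + a) = 0] for the residue [x], and [x] is nonzero at a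
    pole. *)
Lemma ric_pole tau e a b lam P Q : e ^+ 2 = 1 -> tau.[e] != 0 ->
  coprimep P Q -> root Q e -> Q != 0 -> ricpq tau (jeta e a b) lam P Q ->
  exists Q1, [/\ Q = Q1 * ('X - e%:P), ~~ root Q1 e & P.[e] = - a * Q1.[e]].
Proof.
move=> e2 te co rQ Q0; set d := 'X - e%:P; rewrite /ricpq /ricE (jpE e2) => ric.
have d0 : d != 0 by rewrite polyXsubC_eq0.
have e0 : e != 0 by apply: contra_eq_neq e2 => ->; rewrite expr0n eq_sym oner_neq0.
have Pe : P.[e] != 0.
  by apply/negP => /eqP/rootP rP; move: (coprimep_root co rP); rewrite (rootP rQ) eqxx.
have /factor_theorem[Q1 QE] := rQ.
have fin (c x : R) : c = 0 -> c = tau.[e] ^+ 2 * (e + e) * x -> x = 0.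
  move=> -> /esym/eqP; rewrite mulf_eq0 mulf_eq0 expf_eq0 (negPf te) andbF /=.
  by rewrite -mulr2n mulrn_eq0 (negPf e0) => /eqP.
have {}ric : tau ^+ 2 * ('X + e%:P) * (P^`() * Q - P * (Q1 + d * Q1^`()) + P ^+ 2)
   + tau ^+ 2 * jeta e a b * P * Q1 + rpot tau * d * Q1 ^+ 2 - lam%:P * (tau ^+ 2 * d * Q1 ^+ 2) = 0.
  apply: (mulfI d0); rewrite mulr0; move: ric => /eqP; rewrite -subr_eq0 => /eqP ric.
  by rewrite -[RHS]ric QE /d !derivE; ring.
have ev := congr1 (fun p => p.[e]) ric; move: ev.
rewrite /= QE /jeta /d !(hornerD, hornerN, hornerM, hornerC, hornerX, horner_exp) => ev.
have Pa : P.[e] = - a * Q1.[e].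
  apply/eqP; rewrite -subr_eq0; apply/eqP; apply: (mulfI Pe).
  by rewrite mulr0; apply: (fin _ _ ev); ring.
exists Q1; split=> //.
by apply: contraNN Pe => /rootP Q1e; rewrite Pa Q1e mulr0.
Qed.
End RiccatiLocal.

(** * Riccati solutions as logarithmic derivatives *)

Section LogForm.
Variable R : realType.
Implicit Types (tau h f g q y P Q Y M G : {poly R}) (c lam e a b : R).

(* A rational function all of whose poles are simple with integer residues is
   a logarithmic derivative (Y / M)' / (Y / M) up to a polynomial. *)
Lemma log_form tau P Q : Q != 0 ->
  (forall q, irreducible_poly q -> q %| Q -> exists Q1 (z : int),
     [/\ Q = q * Q1, ~~ (q %| Q1), q %| P - z%:~R%:P * q^`() * Q1 &
         (0 <= z) || (q ^+ `|z|%N %| tau)]) ->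
  exists Y M G, [/\ Y != 0, M %| tau, M != 0, (forall f, coprimep f Q -> coprimep f M) &
     P * Y * M = Q * (Y^`() * M - M^`() * Y + G * Y * M)].
Proof.
move: {2}(size Q) (leqnn (size Q)) => n; elim: n P Q => [|n IH] P Q sQ Q0 hQ.
  by move: sQ; rewrite size_poly_leq0 (negPf Q0).
have [Q1|Q1] := leqP (size Q) 1.
  exists 1, 1, ((Q`_0)^-1%:P * P); split; rewrite ?oner_neq0 ?dvd1p //.
    by move=> f _; rewrite coprimep1.
  have c0 : Q`_0 != 0 by apply: contraNneq Q0 => E; rewrite (size1_polyC Q1) E.
  have cV : Q * (Q`_0)^-1%:P = 1 by rewrite {1}(size1_polyC Q1) -polyCM divff.
  transitivity (Q * (Q`_0)^-1%:P * P); first by rewrite cV; ring.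
  by rewrite -[1]/(1%:P) !derivC; ring.
have [q irr qQ] := irredp_factor Q1.
have [Q1' [z [QE qQ1 /dvdpP[P1 PE] hz]]] := hQ q irr qQ.
(* Peeling off one pole: [P / Q = z q' / q + P1 / Q1']. The factor [q ^+ m] goes to [Y] or [M]
   according to the sign of [z]. *)
have {}PE : P = z%:~R%:P * q^`() * Q1' + P1 * q by rewrite -PE; ring.
have q0 := irredp_neq0 irr.
have Q10 : Q1' != 0 by apply: contraNneq qQ1 => ->; rewrite dvdp0.
have sQ1 : (size Q1' <= n)%N.
  move: sQ; rewrite QE size_mul //; have := irr.1.
  by move: (size q) (size Q1') => u v; lia.
have [|Y1 [M1 [G [Y10 M1t M10 cM1 E1]]]] := IH P1 Q1' sQ1 Q10.
  move=> q2 irr2 q2Q1; have q2Q : q2 %| Q by rewrite QE dvdp_mull.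
  have [Q2' [z2 [QE2 q2Q2 q2P hz2]]] := hQ q2 irr2 q2Q.
  have q20 := irredp_neq0 irr2.
  have /dvdpP[Q2 Q1E] := q2Q1.
  have Q2E : Q2' = q * Q2 by apply: (mulfI q20); rewrite -QE2 QE Q1E; ring.
  have q2q : ~~ (q2 %| q).
    apply: contra qQ1 => /(irredp_XsubCP irr)[q21|q2q]; last by rewrite -(eqp_dvdl _ q2q).
    by have := irr2.1; rewrite (eqp_size q21) size_poly1.
  exists Q2, z2; split=> //; first by rewrite Q1E mulrC.
    by apply: contra q2Q2 => h; rewrite Q2E dvdp_mull.
  have : q2 %| q * (P1 - z2%:~R%:P * q2^`() * Q2).
    have -> : q * (P1 - z2%:~R%:P * q2^`() * Q2) =
       (P - z2%:~R%:P * q2^`() * Q2') - (z%:~R%:P * q^`() * Q2) * q2.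
      by rewrite PE Q2E Q1E; ring.
    by rewrite dvdp_sub // dvdp_mulIr.
  by rewrite irredp_prime // (negPf q2q).
have cqM : coprimep q M1 by apply: cM1; rewrite irredp_coprime.
set m := `|z|%N; have dX := mulp_derivX q m.
have [z0|z0] := leP 0 z.
  have zE : z%:~R%:P = m%:R :> {poly R} by rewrite /m -(gez0_abs z0) polyC_natr.
  exists (Y1 * q ^+ m), M1, G; split=> //; first by rewrite mulf_neq0 ?expf_neq0.
    by move=> f; rewrite QE coprimepMr => /andP[_]; apply: cM1.
  transitivity (q * q ^+ m * (P1 * Y1 * M1) + Q1' * Y1 * M1 * (m%:R * q^`() * q ^+ m)).
    by rewrite PE zE; ring.
  by rewrite E1 -dX QE derivM; ring.
have zE : z%:~R%:P = - m%:R :> {poly R}.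
  by rewrite -[z]opprK -(ltz0_abs z0) mulrNz polyCN polyC_natr.
move: hz; rewrite leNgt z0 /= => hz.
exists Y1, (M1 * q ^+ m), G; split=> //.
- by rewrite Gauss_dvdp ?M1t //; rewrite coprimep_expr // coprimep_sym.
- by rewrite mulf_neq0 ?expf_neq0.
- move=> f; rewrite QE !coprimepMr => /andP[fq /cM1->] /=.
  exact: coprimep_expr.
transitivity (q * q ^+ m * (P1 * Y1 * M1) - Q1' * Y1 * M1 * (m%:R * q^`() * q ^+ m)).
  by rewrite PE zE; ring.
by rewrite E1 -dX QE derivM; ring.
Qed.

Lemma top_ltn f n m c : top f n c -> (n < m)%N -> top f m 0.
Proof.
move=> [s _] nm; split; first by rewrite (leq_trans s) // ltnW.
by rewrite nth_default // (leq_trans s).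
Qed.

Lemma top_rpot tau : top (rpot tau) (size tau).-1.*2 0.
Proof.
have [->|t0] := eqVneq tau 0.
  rewrite (_ : rpot 0 = 0); first by split; rewrite ?size_poly0 ?coef0.
  by rewrite /rpot !derivE; ring.
have tt := top_lead t0; have tX := topX R.
have tr := topM (topC 2) (topD (topM (top_jp R) (topB (topM (topB (top_Xderiv (top_Xderiv tt)) (top_Xderiv tt)) tt)
   (topM (top_Xderiv tt) (top_Xderiv tt)))) (topM (topM tX tX) (topM (top_Xderiv tt) tt))).
rewrite (_ : _ * _ = 'X ^+ 2 * rpot tau) in tr; last first.
  by rewrite /rpot -[2%:P]/(2%:R%:P) polyC_natr !derivE; ring.
apply: top_mulX2; apply: (top_eq tr); last by ring.
by rewrite add0n addnn.
Qed.

Lemma top_deriv f n : (size f <= n.+1)%N -> top f^`() n 0.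
Proof.
move=> /leq_sizeP s; split; last by rewrite coef_deriv s ?mul0rn.
by apply/leq_sizeP => j nj; rewrite coef_deriv s ?mul0rn // ltnW.
Qed.

(** A solution vanishes at infinity: otherwise the term in [P ^+ 2] alone would have the highest
    degree. *)
Lemma ric_size tau h lam P Q : tau != 0 -> Q != 0 -> (size h <= 2)%N ->
  ricpq tau h lam P Q -> (size P < size Q)%N.
Proof.
move=> t0 Q0 sh; rewrite /ricpq /ricE => ric; rewrite ltnNge; apply/negP => sQP.
have P0 : P != 0 by rewrite -size_poly_gt0 (leq_trans _ sQP) ?size_poly_gt0.
set N := (size tau).-1; set p := (size P).-1.
have tP : top P p (lead_coef P) := top_lead P0.
have tQ : top Q p Q`_p by split=> //; rewrite prednK ?size_poly_gt0.
have tt : top tau N (lead_coef tau) := top_lead t0.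
have tt2 : top (tau ^+ 2) (N + N) (lead_coef tau ^+ 2) by rewrite !expr2; apply: topM.
have tQ2 : top (Q ^+ 2) (p + p) (Q`_p ^+ 2) by rewrite !expr2; apply: topM.
have tP2 : top (P ^+ 2) (p + p) (lead_coef P ^+ 2) by rewrite !expr2; apply: topM.
have T1 := topM (topM tt2 (top_jp R)) (topD (topB (topM (top_deriv tP.1) tQ) (topM tP (top_deriv tQ.1))) tP2).
have th : top h 1 h`_1 by [].
have lt1 : (N + N + 1 + p + p < N + N + 2 + (p + p))%N by lia.
have lt2 : (N.*2 + (p + p) < N + N + 2 + (p + p))%N by lia.
have lt3 : (0 + (N + N + (p + p)) < N + N + 2 + (p + p))%N by lia.
have T2 := top_ltn (topM (topM (topM tt2 th) tP) tQ) lt1.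
have T3 := top_ltn (topM (top_rpot tau) tQ2) lt2.
have T4 := top_ltn (topM (topC lam) (topM tt2 tQ2)) lt3.
have := (topB (topD (topD T1 T2) T3) T4).2; rewrite ric subrr coef0 => /esym/eqP.
rewrite mul0r mulr0 subrr add0r mulr1 !addr0 subr0 -exprMn expf_eq0 /= mulf_eq0.
by rewrite !lead_coef_eq0 (negPf t0) (negPf P0).
Qed.

Lemma ric_regular tau h lam P Q : tau != 0 -> (size h <= 2)%N -> hasinv tau h ->
  coprimep P Q -> Q != 0 -> ~~ root Q 1 -> ~~ root Q (-1) -> ricpq tau h lam P Q ->
  exists2 y, y != 0 & P * (y * tau) = Q * dl tau 1 y.
Proof.
move=> t0 sh [K [S inv]] co Q0 Q1 Qm1 ric.
have qjp q : irreducible_poly q -> q %| Q -> ~~ (q %| jp R).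
  move=> irr qQ; have aux (x : R) : ~~ root Q x -> ~~ (q %| 'X - x%:P).
    move=> rQ; apply: contra rQ => /(irredp_XsubCP (irredp_XsubC x))[q1|qx].
      by have := irr.1; rewrite (eqp_size q1) size_poly1.
    by rewrite -dvdp_XsubCl -(eqp_dvdl _ qx).
  rewrite (jpE (expr1n _ 2)) irredp_prime // negb_or aux //=.
  by have := aux (-1) Qm1; rewrite polyCN opprK.
have [|Y [M [G [Y0 Mt M0 _ E]]]] := @log_form tau P Q Q0.
  move=> q irr qQ; have [kap [sg [tauE qsg]]] := irredp_factorX irr t0.
  have [z ez] := integral_exponent inv irr tauE qsg (qjp q irr qQ).
  (* For [x = - r < 0] the equation reads [r * (r + 1) = 2 * kap], hence [r <= kap]. *)
  have small (x : int) : x * (x - 1) = 2 * kap%:Z -> (0 <= x) || (q ^+ `|x|%N %| tau).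
    move=> ex; have [//|x0] := leP 0 x; rewrite tauE dvdp_mulr // dvdp_exp2l //.
    have -> : (`|x|%N <= kap)%N = ((`|x|%N)%:Z <= kap%:Z) by [].
    by rewrite ltz0_abs //; nia.
  have [Q1' [QE qQ1 []]] := ric_local irr tauE qsg (qjp q irr qQ) ez co qQ Q0 ric.
    by exists Q1', z; split=> //; apply: small.
  by exists Q1', (1 - z); split=> //; apply: small; rewrite -ez; ring.
(* The polynomial part [G] would dominate at infinity, where [P / Q] and the logarithmic derivatives
   vanish. *)
have G0 : G = 0.
  apply: contraTeq isT => G0.
  have sPQ := ric_size t0 Q0 sh ric.
  have tQ := top_lead Q0; set d := (size Q).-1 in tQ.
  have sP : (size P <= d)%N by rewrite -ltnS /d prednK // size_poly_gt0.
  have tP : top P d 0 by split; [exact: leqW | rewrite nth_default].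
  have tX := topX R; have tY := top_lead Y0; have tM := top_lead M0; have tG := top_lead G0.
  set m := (size Y).-1 in tY; set n := (size M).-1 in tM; set g := (size G).-1 in tG.
  have T1 : top ('X * (P * Y * M)) (1 + (d + g + m + n)) 0.
    have [->|g0] := posnP g.
      by apply: (top_eq (topM tX (topM (topM tP tY) tM))); rewrite ?addn0 ?mul0r ?mulr0.
    by apply: (top_ltn (topM tX (topM (topM tP tY) tM))); move: g0; lia.
  have T2 : top (Q * (('X * Y^`()) * M - ('X * M^`()) * Y)) (1 + (d + g + m + n)) 0.
    have t2 := topM (top_Xderiv tM) tY; rewrite addnC in t2.
    by apply: (top_ltn (topM tQ (topB (topM (top_Xderiv tY) tM) t2))); lia.
  have T3 := topM tX (topM (topM (topM tQ tG) tY) tM).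
  have := (topB (topB T1 T2) T3).2.
  rewrite (_ : _ - _ - _ = 0); last by rewrite E; ring.
  rewrite coef0 !subr0 sub0r mul1r => /esym/eqP; rewrite oppr_eq0 !mulf_eq0 !lead_coef_eq0.
  by rewrite (negPf Q0) (negPf G0) (negPf Y0) (negPf M0).
have /dvdpP[M2 tauE] := Mt.
have M20 : M2 != 0 by apply: contraNneq t0 => M20; rewrite tauE M20 mul0r.
exists (Y * M2); first by rewrite mulf_neq0.
transitivity (M2 ^+ 2 * (P * Y * M)); first by rewrite tauE; ring.
by rewrite E G0 /dl tauE !derivM; ring.
Qed.

(* Subtracting the polar part at a root e of x^2 - 1 amounts to a change of
   gauge which flips the sign of the parameter at e. *)
Lemma ric_unpole tau e a b lam P Q : e ^+ 2 = 1 -> tau.[e] != 0 ->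
  coprimep P Q -> Q != 0 -> ricpq tau (jeta e a b) lam P Q ->
  exists s P1 Q1, [/\ s = 0 \/ s = a, (s != 0) = root Q e,
   [/\ coprimep P1 Q1, Q1 != 0, ~~ root Q1 e & forall x, x != e -> root Q1 x = root Q x],
   P * (Q1 * ('X - e%:P)) = Q * (P1 * ('X - e%:P) - s%:P * Q1) &
   ricpq tau (jeta e (a - 2 * s) b) (lam + s * (b + 1)) P1 Q1].
Proof.
move=> e2 te co Q0 ric; set d := 'X - e%:P.
have d0 : d != 0 by rewrite polyXsubC_eq0.
have [rQ|rQ] := boolP (root Q e); last first.
  exists 0, P, Q; split=> //; [by left | by rewrite eqxx | by ring | ].
  by rewrite mulr0 subr0 mul0r addr0.
have [Q1 [QE rQ1 Pe]] := ric_pole e2 te co rQ Q0 ric.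
have : root (P + a%:P * Q1) e by rewrite /root hornerD hornerM hornerC Pe mulNr addNr.
move=> /factor_theorem[P1 P1E].
have PE : P = P1 * d - a%:P * Q1 by rewrite -P1E; ring.
have Q10 : Q1 != 0 by apply: contraNneq rQ1 => ->; rewrite root0.
have a0 : a != 0.
  have coS : coprimep Q P by rewrite coprimep_sym.
  by apply/negP => /eqP a0; move: (coprimep_root coS rQ); rewrite Pe a0 oppr0 mul0r eqxx.
exists a, P1, Q1; split.
- by right.
- by rewrite a0.
- split=> //.
    apply/coprimepP => g gP gQ; have /coprimepP := co; apply.
      by rewrite PE; apply: dvdp_sub; [apply: dvdp_mulr | apply: dvdp_mull].
    by rewrite QE dvdp_mulr.
  by move=> x xe; rewrite QE rootM root_XsubC (negPf xe) orbF.
- by rewrite QE PE /d; ring.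
- by move: ric; rewrite QE PE /d ricpq_gauge // subrr mulr0.
Qed.
End LogForm.

(** * Classification of Riccati solutions by their exponents at 1 and -1 *)

Section RiccatiClasses.
Variable R : realType.
Implicit Types (tau h f g q y z P Q : {poly R}) (c lam e a b s t : R).

(* wnum / wden = y'/y - tau'/tau - s/(x-1) - t/(x+1) *)
Definition wden tau y : {poly R} := y * tau * (('X - 1%:P) * ('X - (-1)%:P)).
Definition wnum tau s t y : {poly R} :=
  dl tau 1 y * (('X - 1%:P) * ('X - (-1)%:P))
  - (s%:P * ('X - (-1)%:P) + t%:P * ('X - 1%:P)) * (y * tau).

Lemma size_jeta e a b : (size (jeta e a b) <= 2)%N.
Proof.
rewrite /jeta (leq_trans (size_polyD _ _)) // geq_max !mul_polyC.
by rewrite !(leq_trans (size_scale_leq _ _)) ?size_XsubC ?size_XaddC.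
Qed.

Lemma hasinv_class tau a b s t : tau.[1] != 0 -> tau.[-1] != 0 ->
  hasinv tau (jeta 1 a b) -> s = 0 \/ s = a -> t = 0 \/ t = b ->
  hasinv tau (jeta 1 (a - 2 * s) (b - 2 * t)).
Proof.
move=> t1 tm inv hs ht.
have {}inv : hasinv tau (jeta 1 (a - 2 * s) b).
  case: hs => ->; first by rewrite mulr0 subr0.
  by rewrite (_ : a - 2 * a = - a); [apply: hasinv_flip1 | ring].
case: ht => ->; first by rewrite mulr0 subr0.
by rewrite (_ : b - 2 * b = - b); [apply: hasinv_flip2 | ring].
Qed.

(** A zero of [y] at [e] would give the logarithmic derivative a pole with residue its multiplicity,
    as [tau] does not vanish there. *)
Lemma logder_regular tau P Q y e : tau.[e] != 0 -> y != 0 -> ~~ root Q e ->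
  P * (y * tau) = Q * dl tau 1 y -> y.[e] != 0.
Proof.
move=> te y0 rQ E; set d := 'X - e%:P.
have [m [r [yE]]] := irredp_factorX (irredp_XsubC e) y0; rewrite dvdp_XsubCl => rr.
case: m yE => [|m] yE; first by rewrite yE mul1r.
have d0 : d != 0 by rewrite polyXsubC_eq0.
have : P * r * tau * d = Q * (tau * (m.+1%:R * r + d * r^`()) - tau^`() * r * d).
  apply: (@mulfI _ (d ^+ m.+1)); first by rewrite expf_neq0.
  transitivity (d * (P * (y * tau))); first by rewrite yE -/d; ring.
  rewrite E /dl yE -/d derivM.
  transitivity (Q * (tau * ((d * (d ^+ m.+1)^`()) * r + d * d ^+ m.+1 * r^`()) - tau^`() * (d ^+ m.+1 * r) * d)).
    by ring.
  by rewrite mulp_derivX /d derivXsubC; ring.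
move=> /(congr1 (fun p => p.[e])).
rewrite /d !(hornerXsubC, hornerM, hornerD, hornerN) subrr !(mulr0, mul0r, addr0, subr0).
rewrite -polyC_natr hornerC => /esym/eqP; rewrite !mulf_eq0 (negPf te) pnatr_eq0 /=.
by rewrite -!rootE (negPf rQ) (negPf rr).
Qed.

(** The poles at 1 and -1 are removed in turn by [ric_unpole]; [ric_regular] handles the remainder,
    and the eigenvalue collects both gauge shifts. *)
Lemma ric_class tau a b lam P Q : tau.[1] != 0 -> tau.[-1] != 0 ->
  hasinv tau (jeta 1 a b) -> coprimep P Q -> Q != 0 -> ricpq tau (jeta 1 a b) lam P Q ->
  exists s t y, [/\ (s = 0 \/ s = a) /\ (t = 0 \/ t = b),
    (s != 0) = root Q 1 /\ (t != 0) = root Q (-1),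
    [/\ y != 0, y.[1] != 0 & y.[-1] != 0],
    P * wden tau y = Q * wnum tau s t y &
    nop tau (jeta 1 (a - 2 * s) (b - 2 * t)) 1 y
      = (lam + s * (b + 1) + t * (a - 2 * s + 1))%:P * tau ^+ 2 * y].
Proof.
move=> t1 tm inv co Q0 ric.
have tau0 : tau != 0 by apply: contraNneq t1 => ->; rewrite horner0.
have [s [P1 [Q1 [hs sE [co1 Q10 rQ1 rQ1x] E1 ric1]]]] := ric_unpole (expr1n _ 2) t1 co Q0 ric.
have m1 : (-1) ^+ 2 = 1 :> R by rewrite sqrrN expr1n.
rewrite jetaN in ric1.
have [t [P2 [Q2 [ht tE [co2 Q20 rQ2 rQ2x] E2 ric2]]]] := ric_unpole m1 tm co1 Q10 ric1.
rewrite -jetaN in ric2.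
have n11 : 1 != -1 :> R by rewrite -subr_eq0 opprK -[1 + 1]/(2%:R) pnatr_eq0.
have r21 : ~~ root Q2 1 by rewrite rQ2x.
have [y y0 E3] := ric_regular tau0 (size_jeta _ _ _) (hasinv_class t1 tm inv hs ht) co2 Q20 r21 rQ2 ric2.
exists s, t, y; split=> //.
- by rewrite sE tE rQ1x // eq_sym.
- by split=> //; [apply: (logder_regular t1 y0 r21 E3) | apply: (logder_regular tm y0 rQ2 E3)].
- apply: (@mulfI _ (Q1 * Q2)); first by rewrite mulf_neq0.
  rewrite /wden /wnum; set d1 := 'X - 1%:P in E1 *; set d2 := 'X - (-1)%:P in E2 *.
  transitivity ((P * (Q1 * d1)) * (Q2 * (y * tau) * d2)); first by ring.
  rewrite E1; transitivity (Q * d1 * (y * tau) * (P1 * (Q2 * d2)) - Q * s%:P * Q1 * Q2 * (y * tau) * d2).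
    by ring.
  rewrite E2; transitivity (Q * Q1 * d1 * d2 * (P2 * (y * tau)) - Q * Q1 * Q2 * (s%:P * d2 + t%:P * d1) * (y * tau)).
    by ring.
  by rewrite E3; ring.
apply/(ricpq_nop _ _ _ tau0 y0).
have yt0 : y * tau != 0 by rewrite mulf_neq0.
have E3' : P2 * (y * tau) = dl tau 1 y * Q2 by rewrite E3 mulrC.
exact: (ricpq_cross _ _ _ Q20 yt0 E3').1 ric2.
Qed.
End RiccatiClasses.

(** * Residue pairing and moment functionals *)

Section Residues.
Variable R : realType.
Implicit Types (G h f g q y z Z : {poly R}) (c : R) (k : nat -> R).

(* Up to the leading coefficient of G, the residue at infinity of h / G. *)
Definition rho G h : R := (h %% G)`_(size G).-2.

Lemma rho_lin G c y z : rho G (c%:P * y + z) = c * rho G y + rho G z.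
Proof. by rewrite /rho modpD mul_polyC modpZl coefD coefZ. Qed.

Lemma rho_dvd G h : G %| h -> rho G h = 0.
Proof. by rewrite /rho => /modp_eq0P->; rewrite coef0. Qed.

Lemma rho_small G h : (size h < size G)%N -> rho G h = h`_(size G).-2.
Proof. by move=> s; rewrite /rho modp_small. Qed.

Lemma rho_top G n : (1 < size G)%N -> (n <= (size G).-2)%N ->
  rho G 'X^n = (n == (size G).-2)%:R.
Proof.
move=> s1 sn; rewrite rho_small ?coefXn 1?eq_sym //.
by rewrite size_polyXn; lia.
Qed.

Lemma lin_ext (L : {poly R} -> R) n y : (forall c f g, L (c%:P * f + g) = c * L f + L g) ->
  (size y <= n)%N -> (forall i, (i < n)%N -> L 'X^i = 0) -> L y = 0.
Proof.
move=> Ll sy h; have L0 : L 0 = 0.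
  by have := Ll (-1) 0 0; rewrite mulr0 addr0 mulN1r addNr.
elim: n y sy h => [|n IH] y sy h.
  by move: sy; rewrite size_poly_leq0 => /eqP->.
have -> : y = (y`_n)%:P * 'X^n + (y - (y`_n)%:P * 'X^n) by ring.
rewrite Ll h // mulr0 add0r; apply: IH => [|i ni]; last by apply/h/ltnW.
have tX : top ((y`_n)%:P * 'X^n) n y`_n.
  split; last by rewrite coefCM coefXn eqxx mulr1.
  by rewrite mul_polyC (leq_trans (size_scale_leq _ _)) // size_polyXn.
apply: top0_size; apply: (top_eq (topB (conj sy erefl) tX)) => //; exact: subrr.
Qed.

(** The pairing [rho G (y * Z)] on polynomials modulo [G] is triangular on monomials, hence perfect;
    vanishing of the first [n0] moments bounds the degree of [Z]. *)
Lemma frobenius_dual G k n0 : (1 < size G)%N -> (forall j, (j < n0)%N -> k j = 0) ->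
  exists Z, (size Z <= (size G).-1 - n0)%N /\
    forall i, (i < (size G).-1)%N -> rho G ('X^i * Z) = k i.
Proof.
move=> s1 k0; set D := (size G).-1.
suff H n : (n <= D)%N -> exists Z, (size Z <= D - n0)%N /\
    forall i, (i < n)%N -> rho G ('X^i * Z) = k i by apply: H.
elim: n => [_|n IH nD]; first by exists 0; rewrite size_poly0.
have [Z [sZ hZ]] := IH (ltnW nD).
have [nn0|nn0] := ltnP n n0.
  exists Z; split=> // i; rewrite ltnS leq_eqVlt => /orP[/eqP->|/hZ//].
  rewrite k0 //; have sX : (size ('X^n * Z)%R < D)%N.
    rewrite (leq_ltn_trans (size_polyMleq _ _)) // size_polyXn.
    by move: sZ nn0 nD; move: (size Z) => u; lia.
  rewrite rho_small; last by rewrite (ltn_trans sX) // /D; lia.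
  by rewrite nth_default // -ltnS prednK // /D; lia.
(* The added monomial pairs to 0 with ['X^i] for [i < n] and to 1 with ['X^n]. *)
pose c := k n - rho G ('X^n * Z); exists (c%:P * 'X^(D.-1 - n) + Z); split.
  rewrite (leq_trans (size_polyD _ _)) // geq_max sZ andbT mul_polyC.
  by rewrite (leq_trans (size_scale_leq _ _)) // size_polyXn; lia.
move=> i; rewrite ltnS => ni.
have -> : 'X^i * (c%:P * 'X^(D.-1 - n) + Z) = c%:P * 'X^(i + (D.-1 - n)) + 'X^i * Z.
  by rewrite exprD; ring.
rewrite rho_lin rho_top //; last by rewrite /D in nD *; lia.
move: ni; rewrite leq_eqVlt => /orP[/eqP->|ni].
  by rewrite subnKC; [rewrite eqxx mulr1 /c subrK | rewrite /D in nD *; lia].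
rewrite hZ // (_ : (_ == _) = false) ?mulr0 ?add0r //.
by apply/negbTE; rewrite /D in nD *; lia.
Qed.

Definition kap k y := \sum_(i < size y) y`_i * k i.

Lemma kapE k n y : (size y <= n)%N -> kap k y = \sum_(i < n) y`_i * k i.
Proof.
move=> sy; rewrite /kap (big_ord_widen n (fun i => y`_i * k i)) // big_mkcond.
by apply: eq_bigr => i _; case: ltnP => // yi; rewrite nth_default ?mul0r.
Qed.

Lemma kap_lin k c y z : kap k (c%:P * y + z) = c * kap k y + kap k z.
Proof.
set n := maxn (size y) (maxn (size z) (size (c%:P * y + z))).
rewrite !(@kapE k n) ?leq_max ?leqnn ?orbT //.
rewrite mulr_sumr -big_split; apply: eq_bigr => i _ /=.
by rewrite coefD coefCM; ring.
Qed.

Lemma kapXn k n : kap k 'X^n = k n.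
Proof.
rewrite (@kapE k n.+1) ?size_polyXn // big_ord_recr /= coefXn eqxx mul1r big1 ?add0r // => i _.
by rewrite coefXn ltn_eqF ?mul0r.
Qed.

Lemma strong_recursion (F : nat -> seq R -> R) :
  exists k, forall j, k j = F j (mkseq k j).
Proof.
pose L := fix L j := if j is j'.+1 then rcons (L j') (F j' (L j')) else [::].
have sL j : size (L j) = j by elim: j => //= j IH; rewrite size_rcons IH.
pose k j := F j (L j); exists k => j; rewrite {1}/k; congr (F j _).
by elim: j => //= j IH; rewrite mkseqS -IH.
Qed.

(** The system is triangular: for [n > n1] the top coefficient of [W n] determines the moment of
    index [n + l], while its vanishing at [n1] leaves that moment free to be 1. *)
Lemma moments_exist (W : nat -> {poly R}) n1 l :
  (forall n, (size (W n) <= (n + l).+1)%N) -> (W n1)`_(n1 + l) = 0 ->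
  (forall n, (n1 < n)%N -> (W n)`_(n + l) != 0) ->
  exists k, [/\ forall j, (j < n1 + l)%N -> k j = 0, k (n1 + l)%N = 1 & forall n, kap k (W n) = 0].
Proof.
move=> sW W1 Wn.
have [k kE] := strong_recursion (fun j s =>
  if (j < n1 + l)%N then 0 else if (j == n1 + l)%N then 1 else
  - (\sum_(i < j) (W (j - l)%N)`_i * s`_i) / (W (j - l)%N)`_j).
have k0 j : (j < n1 + l)%N -> k j = 0 by move=> h; rewrite kE h.
exists k; split=> //; first by rewrite kE ltnn eqxx.
move=> n; rewrite (kapE _ (sW n)) big_ord_recr /=.
have [nn1|nn1|->] := ltngtP n n1.
- by rewrite (k0 (n + l)%N) ?ltn_add2r // mulr0 addr0 big1 // => i _;
     rewrite k0 ?mulr0 // (ltn_trans (ltn_ord i)) // ltn_add2r.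
- rewrite [X in _ * X]kE ltn_add2r ltnNge (ltnW nn1) /= eqn_add2r (gtn_eqF nn1) addnK.
  rewrite mulrC divfK ?Wn //; apply/eqP; rewrite subr_eq0; apply/eqP.
  by apply: eq_bigr => i _; rewrite nth_mkseq.
- by rewrite W1 mul0r addr0 big1 // => i _; rewrite k0 ?mulr0.
Qed.
End Residues.

(** * A rational solution of the adjoint equation *)

Section DualSolution.
Variable R : realType.
Variables (tau h : {poly R}).
Hypotheses (tau0 : tau != 0) (sh : (size h <= 2)%N).
Implicit Types (f g y z Z : {poly R}) (c lam : R).
Local Notation N := (size tau).-1.

Lemma size_tauX n : size (tau ^+ n) = (n * N).+1.
Proof. by rewrite -[LHS]prednK ?size_exp ?size_poly_gt0 ?expf_neq0 // mulnC. Qed.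

Lemma dl_tauX c n y : dl tau (c + n%:R) (tau ^+ n * y) = tau ^+ n * dl tau c y.
Proof.
elim: n => [|n IH]; first by rewrite !expr0 !mul1r addr0.
rewrite exprS -mulrA -natr1 addrA; set w := tau ^+ n * y in IH *.
transitivity (tau * dl tau (c + n%:R) w); last by rewrite IH; ring.
by rewrite /dl derivM polyCD; ring.
Qed.

(* (phi / tau^m)' has no residue at infinity. *)
Lemma rho_dl m phi : (0 < m)%N -> (0 < N)%N -> rho (tau ^+ m.+1) (dl tau m%:R phi) = 0.
Proof.
move=> m0 N0; set G := tau ^+ m.
have -> : dl tau m%:R phi = 1%:P * (tau ^+ m.+1 * (phi %/ G)^`()) + dl tau m%:R (phi %% G).
  have := dl_tauX 0 m (phi %/ G); rewrite add0r {2}/dl polyC0 !mul0r subr0 mulrA -exprSr => <-.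
  rewrite mul1r {1}(divp_eq phi G) /dl !derivE -/G; ring.
rewrite rho_lin rho_dvd ?dvdp_mulr // mulr0 add0r.
set r := phi %% G.
have sr : (size r <= m * N)%N by rewrite -ltnS -size_tauX ltn_modp expf_neq0.
have tr : top r (m * N).-1 r`_(m * N).-1.
  by split=> //; rewrite prednK // muln_gt0 m0.
have tt := top_lead tau0.
have := topB (topM tt (top_Xderiv tr)) (topM (topC m%:R) (topM (top_Xderiv tt) tr)).
rewrite (_ : _ - _ = 'X * dl tau m%:R r); last by rewrite /dl; ring.
move=> [/leq_sizeP s _].
have sd : (size (dl tau m%:R r) <= N + (m * N).-1)%N.
  by apply/leq_sizeP => j hj; have := s j.+1; rewrite coefXM /=; apply.
rewrite rho_small size_tauX mulSn; last first.
  by apply: (leq_trans sd); rewrite leq_add2l leq_pred.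
have mN : (0 < m * N)%N by rewrite muln_gt0 m0.
rewrite nth_default //= (leq_trans sd) //.
by move: mN; move: (m * N)%N N => u n; lia.
Qed.

Variables (K : nat) (S : {poly R} -> Prop).
Hypothesis inv : invsub tau h K S.

Lemma dual_solution lam (m : int) : (0 < N)%N ->
  (forall y, S y -> nop tau h 1 y = lam%:P * tau ^+ 2 * y -> y = 0) ->
  m%:~R * (m%:~R - 1 + h`_1) = lam ->
  (forall j : int, m < j -> j%:~R * (j%:~R - 1 + h`_1) != lam) ->
  exists2 Z, Z != 0 &
    nop tau (4 * 'X - h) K%:R Z = (lam - 2 + h`_1)%:P * tau ^+ 2 * Z.
Proof.
move=> N0 inj hm hj.
(* The test functions ['X^n / tau^k] then include one of growth [m] at infinity, at [n = n1]. *)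
pose j := `|m|%N; pose k := j.+1.
pose n1 := `|((k * N)%:Z + m)%R|%N.
have n1E : n1%:Z = (k * N)%:Z + m.
  rewrite /n1 gez0_abs //; have : (k <= k * N)%N by rewrite leq_pmulr.
  by rewrite {1}/k /j; move: (k * N)%N => u; lia.
have chiE (n : nat) : chi tau h k%:R n = (n%:Z - (k * N)%:Z)%:~R * ((n%:Z - (k * N)%:Z)%:~R - 1 + h`_1).
  by rewrite /chi intrB -!pmulrn natrM.
pose W n := nop tau h k%:R 'X^n - lam%:P * tau ^+ 2 * 'X^n.
have tX n : top ('X^n : {poly R}) n 1.
  by split; rewrite ?size_polyXn // coefXn eqxx.
have tW n := top_nop tau0 sh k%:R lam (tX n).
have [||kk [kk0 kk1 kkW]] := @moments_exist R W n1 N.*2 (fun n => (tW n).1).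
- by rewrite (tW n1).2 chiE n1E addrAC subrr add0r hm subrr !mul0r.
- move=> n nn1; rewrite (tW n).2 chiE mulr1 mulf_neq0 ?expf_neq0 ?lead_coef_eq0 //.
  by rewrite subr_eq0; apply: hj; move: nn1; rewrite -ltz_nat n1E; lia.
have kap0 y : kap kk (nop tau h k%:R y - lam%:P * tau ^+ 2 * y) = 0.
  apply: (@lin_ext R (fun y => kap kk (nop tau h k%:R y - lam%:P * tau ^+ 2 * y)) (size y)) => //; last by move=> i _; apply: kkW.
  move=> c f g; rewrite -kap_lin; congr kap; rewrite nopD nopZ; ring.
(* This is [k + K + 2], the denominator exponent in the Lagrange identity for exponents [k] and [K];
   it also splits as [j + (2 + K.+1)], which puts the multiples of [G] in the image. *)
pose M := (j + K + 3)%N; pose G := tau ^+ M.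
have sG : size G = (M * N).+1 by rewrite size_tauX.
have MN : (0 < M * N)%N by rewrite muln_gt0 N0 /M addn3.
have kapG g : kap kk (G * g) = 0.
  have Sg : S (tau ^+ K.+1 * g) by case: inv => _ _ h0; rewrite exprSr -mulrA.
  have [v [Sv _ ev]] := inv_surj tau0 sh inv inj Sg (leqnn _).
  have <- : nop tau h k%:R (tau ^+ j * v) - lam%:P * tau ^+ 2 * (tau ^+ j * v) = G * g.
    have kE : k%:R = 1 + j%:R :> R by rewrite /k -natr1 addrC.
    rewrite kE nop_tauX; transitivity (tau ^+ j * (tau ^+ 2 * (tau ^+ K.+1 * g))).
      by rewrite -ev; ring.
    by rewrite /G (_ : M = j + (2 + K.+1))%N ?exprD ?mulrA // /M; lia.
  exact: kap0.
have s1 : (1 < size G)%N by rewrite sG ltnS.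
have [Z [sZ hZ]] := frobenius_dual s1 kk0.
rewrite sG /= in sZ hZ.
(* The functional kills the ideal of [G], so its moment series is the rational function [Z / G] up
   to a constant. *)
have kapZ y : kap kk y = rho G (y * Z).
  apply/eqP; rewrite -subr_eq0; apply/eqP.
  rewrite (divp_eq y G); set q := y %/ G; set r := y %% G.
  pose L y := kap kk y - rho G (y * Z).
  have Ll c f g : L (c%:P * f + g) = c * L f + L g.
    rewrite /L kap_lin mulrDl -mulrA rho_lin; ring.
  rewrite -/(L _) -[q * G]mul1r -[1]/(1%:P) Ll mul1r.
  have -> : L (q * G) = 0.
    by rewrite /L mulrC kapG rho_dvd ?subrr // -mulrA dvdp_mulr.
  rewrite add0r; apply: (lin_ext (n := (M * N)%N) Ll).
    by rewrite -ltnS -sG ltn_modp -size_poly_gt0 sG.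
  by move=> i iM; rewrite /L kapXn hZ // subrr.
have Z0 : Z != 0.
  apply: contra_eq_neq (kapZ 'X^(n1 + N.*2)) => ->.
  by rewrite kapXn kk1 mulr0 rho_dvd ?dvdp0 // oner_neq0.
exists Z => //.
have h'E : h^`() = (h`_1)%:P.
  apply/polyP => i; rewrite coef_deriv coefC; case: i => [|i] //=.
  by rewrite nth_default ?mul0rn // (leq_trans sh).
pose X := nop tau (4 * 'X - h) K%:R Z - (lam - 2 + h`_1)%:P * tau ^+ 2 * Z.
apply/eqP; rewrite -subr_eq0 -/X.
have rhoX y : rho G (y * X) = 0.
  pose phi := jp R * (dl tau k%:R y * Z - y * dl tau K%:R Z) + (h - 2 * 'X) * tau * y * Z.
  have -> : y * X = (-1)%:P * dl tau (k%:R + K%:R + 1) phi + (nop tau h k%:R y - lam%:P * tau ^+ 2 * y) * Z.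
    by rewrite /phi -nop_adj /X h'E; ring.
  rewrite rho_lin -kapZ kap0 addr0 -natrD natr1 /G (_ : M = (k + K).+2) ?rho_dl ?mulr0 //.
  by rewrite /M /k; lia.
(* Every [y * X] has zero residue, while a nonzero [X] of size at most [M * N] can be shifted by a
   monomial so that its leading coefficient is the residue. *)
apply: contraT => X0.
have sX : (size X <= M * N)%N.
  have s4 : (size (4 * 'X - h)%R <= 2)%N.
    rewrite (leq_trans (size_polyD _ _)) // geq_max size_polyN sh andbT.
    by rewrite -[4]/(4%:R) -polyC_natr mul_polyC (leq_trans (size_scale_leq _ _)) // size_polyX.
  have := nop_size tau0 s4 K%:R (lam - 2 + h`_1) sZ; rewrite -/X.
  have : (0 < size Z)%N by rewrite size_poly_gt0.
  clear -sZ; clearbody n1.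
  by move: sZ; move: (size Z) (size X) (M * N)%N N => u v w n; lia.
have := rhoX 'X^(M * N - size X); have sX0 : (0 < size X)%N by rewrite size_poly_gt0.
have sXX : size ('X^(M * N - size X) * X) = (M * N)%N.
  by rewrite mulrC size_mulXn // subnK.
rewrite rho_small ?sXX ?sG //= => /eqP.
by rewrite -{2}sXX -lead_coefE lead_coefM lead_coefXn mul1r lead_coef_eq0 (negPf X0).
Qed.
End DualSolution.

(** * The smaller exponent at an integer parameter *)

Section IntegerParameter.
Variable R : realType.
Implicit Types (tau h f g q y z p : {poly R}) (c lam e a b : R).

Lemma finite_roots p : p != 0 -> exists s : seq R, forall x, root p x -> x \in s.
Proof.
move: {2}(size p) (leqnn (size p)) => n; elim: n p => [|n IH] p sp p0.
  by move: sp; rewrite size_poly_leq0 (negPf p0).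
have [[x rx]|nr] := pselect (exists x, root p x); last first.
  by exists [::] => x rx; case: nr; exists x.
have /factor_theorem[q pE] := rx.
have q0 : q != 0 by apply: contraNneq p0 => q0; rewrite pE q0 mul0r.
have [|s hs] := IH q _ q0.
  by move: sp; rewrite pE size_mul ?polyXsubC_eq0 // size_XsubC addn2.
exists (x :: s) => z; rewrite pE rootM root_XsubC inE => /orP[/hs->|->] //.
by rewrite orbT.
Qed.

Lemma nop_XsubCX tau e b r g : e ^+ 2 = 1 -> exists f,
  nop tau (jeta e (- r%:R) b) 1 (('X - e%:P) ^+ r * g) = ('X - e%:P) ^+ r * f.
Proof.
move=> e2; have d0 : ('X - e%:P : {poly R}) != 0 by rewrite polyXsubC_eq0.
have := gop_shiftX tau (- r%:R) b (- r%:R) r g e2; rewrite addNr gop0 gop_end => E.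
eexists; apply: (mulfI d0); rewrite E mulrCA; reflexivity.
Qed.

(* Solutions with the smaller of two integer exponents at e are eigenvectors of
   an operator on the finite-dimensional space of polynomials modulo (X - e)^r. *)
Lemma bad_spectrum tau e b r : e ^+ 2 = 1 -> tau.[e] != 0 -> exists s : seq R,
  forall lam y, nop tau (jeta e (- r%:R) b) 1 y = lam%:P * tau ^+ 2 * y -> y.[e] != 0 ->
    (0 < r)%N -> lam \in s.
Proof.
move=> e2 te; set d := 'X - e%:P; set A := nop _ _ 1.
have d0 : d != 0 by rewrite polyXsubC_eq0.
have co : coprimep (d ^+ r) (tau ^+ 2).
  by rewrite coprimep_expl // coprimep_expr // coprimep_sym coprimep_XsubC.
have sd : size (d ^+ r) = r.+1 by rewrite size_exp_XsubC.
have /Bezout_eq1_coprimepP[[u v] /= uv] := co.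
(* Here [v] inverts [tau ^+ 2] modulo [d ^+ r], so [B] is the operator induced on the quotient. *)
pose B (w : 'rV[R]_r) : 'rV[R]_r := poly_rV ((v * A (rVpoly w)) %% d ^+ r).
have Bl : linear B.
  move=> k w1 w2; rewrite /B linearP /= -mul_polyC /A nop_lin mulrDr mulrCA modpD.
  by rewrite mul_polyC modpZl linearP.
pose BM := HB.pack B (GRing.isLinear.Build R _ _ _ B Bl) : {linear 'rV[R]_r -> 'rV[R]_r}.
have [s hs] := finite_roots (monic_neq0 (char_poly_monic (lin1_mx BM))).
exists s => lam y ey ye r0; apply: hs; rewrite -eigenvalue_root_char.
pose y0 := y %% d ^+ r.
have sy0 : (size y0 <= r)%N by rewrite -ltnS -sd ltn_modp expf_neq0.
have dr m : (d ^+ r * m) %% d ^+ r = 0 by apply/modp_eq0P; rewrite dvdp_mulr.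
apply/eigenvalueP; exists (poly_rV y0).
  rewrite mul_rV_lin1 /= /B poly_rV_K // -linearZ /=; congr poly_rV.
  have [f fE] := nop_XsubCX tau b r (y %/ d ^+ r) e2.
  have -> : v * A y0 = d ^+ r * (- v * f - lam%:P * u * y + lam%:P * (y %/ d ^+ r)) + lam%:P * y0.
    have -> : A y0 = lam%:P * tau ^+ 2 * y - d ^+ r * f.
      rewrite -fE -ey -nopB; congr nop.
      by rewrite {1}(divp_eq y (d ^+ r)) mulrC addrAC subrr add0r.
    transitivity (lam%:P * y - lam%:P * u * d ^+ r * y - v * d ^+ r * f).
      by have -> : v * (lam%:P * tau ^+ 2 * y - d ^+ r * f) = lam%:P * (v * tau ^+ 2) * y - v * d ^+ r * f by [ring];
         rewrite (_ : v * tau ^+ 2 = 1 - u * d ^+ r); [ring | rewrite -uv; ring].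
    have yE : y = d ^+ r * (y %/ d ^+ r) + y0 by rewrite {1}(divp_eq y (d ^+ r)) mulrC.
    transitivity (lam%:P * (d ^+ r * (y %/ d ^+ r) + y0) - lam%:P * u * d ^+ r * y - v * d ^+ r * f).
      by rewrite -yE.
    by ring.
  by rewrite modpD dr add0r mul_polyC modpZl modp_small ?sd.
apply: contraNneq ye => /(congr1 rVpoly); rewrite poly_rV_K // linear0 => y00.
rewrite (divp_eq y (d ^+ r)) -/y0 y00 addr0 hornerM horner_exp hornerXsubC subrr.
by rewrite expr0n eqn0Ngt r0 mulr0.
Qed.
End IntegerParameter.

(** * Reduced fractions and solvability under gauge change *)

Section RationalFunctions.
Variable R : realType.
Implicit Types (tau y z P Q : {poly R}) (c lam a b s t : R) (w : ratfun R).

Lemma rden_neq0 w : rden w != 0.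
Proof. by have /andP[/monic_neq0] := valP w. Qed.

Lemma ratfun_coprime w : coprimep (rnum w) (rden w).
Proof. by have /andP[] := valP w. Qed.

Lemma ratfun_eq w1 w2 : rnum w1 * rden w2 = rnum w2 * rden w1 -> w1 = w2.
Proof.
move=> E; apply: val_inj; move: (valP w1) (valP w2) E (ratfun_coprime w1) (ratfun_coprime w2).
rewrite /rnum /rden; case: (val w1) => P1 Q1; case: (val w2) => P2 Q2 /= /andP[m1 _] /andP[m2 _].
move=> E c1 c2.
have QE : Q1 = Q2.
  apply/eqP; rewrite -eqp_monic // /eqp; apply/andP; split.
    by rewrite -(@Gauss_dvdpr _ _ P1) 1?coprimep_sym // E dvdp_mulIr.
  by rewrite -(@Gauss_dvdpr _ _ P2) 1?coprimep_sym // -E dvdp_mulIr.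
by rewrite QE in E *; move: E => /(mulIf (monic_neq0 m2)) ->.
Qed.

Lemma ratfun_ex P Q : Q != 0 -> exists w, rnum w * Q = P * rden w.
Proof.
move=> Q0; set g := gcdp P Q.
have g0 : g != 0 by rewrite gcdp_eq0 (negPf Q0) andbF.
have PE : P = P %/ g * g by rewrite divpK // dvdp_gcdl.
have QE : Q = Q %/ g * g by rewrite divpK // dvdp_gcdr.
have Q10 : Q %/ g != 0 by apply: contraNneq Q0 => h; rewrite QE h mul0r.
set l := lead_coef (Q %/ g); have l0 : l != 0 by rewrite lead_coef_eq0.
have h : ((l^-1 *: (P %/ g), l^-1 *: (Q %/ g)).2 \is monic) &&
     coprimep (l^-1 *: (P %/ g), l^-1 *: (Q %/ g)).1 (l^-1 *: (P %/ g), l^-1 *: (Q %/ g)).2.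
  rewrite /= monicE lead_coefZ mulVf // eqxx /= coprimepZl ?invr_eq0 // coprimepZr ?invr_eq0 //.
  by rewrite coprimep_div_gcd // Q0 orbT.
exists (exist _ (l^-1 *: (P %/ g), l^-1 *: (Q %/ g)) h : ratfun R); rewrite /rnum /rden /= [in LHS]QE [in RHS]PE.
by rewrite -!mul_polyC; ring.
Qed.

Definition ric_solvable tau a b lam := exists P Q, Q != 0 /\ ricpq tau (jeta 1 a b) lam P Q.

Lemma sigma_ric_solvable tau a b lam : sigma_qr (Trg tau a b) lam <-> ric_solvable tau a b lam.
Proof.
split=> [[w /Ric_ricpq h]|[P [Q [Q0 h]]]].
  by exists (rnum w), (rden w); split=> //; apply: rden_neq0.
have [w wE] := ratfun_ex P Q0; exists w; apply/Ric_ricpq.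
exact: (ricpq_cross _ _ _ (rden_neq0 w) Q0 wE).2 h.
Qed.

Lemma ric_solvable_nop tau a b lam c y : tau != 0 -> y != 0 ->
  nop tau (jeta 1 a b) c y = lam%:P * tau ^+ 2 * y -> ric_solvable tau a b lam.
Proof.
move=> t0 y0 /(ricpq_nop _ _ _ t0 y0) h.
by exists (dl tau c y), (y * tau); split; rewrite ?mulf_neq0.
Qed.

Lemma ric_solvable_gauge1 tau a b lam : ric_solvable tau (- a) b (lam + a * (b + 1)) -> ric_solvable tau a b lam.
Proof.
move=> [P [Q [Q0]]].
have -> : - a = a - 2 * a by ring.
have sa : a * (a - a) = 0 by rewrite subrr mulr0.
move=> /(ricpq_gauge _ _ _ _ _ (expr1n _ 2) sa) h.
by eexists; eexists; split; last exact: h; rewrite mulf_neq0 ?polyXsubC_eq0.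
Qed.

Lemma ric_solvable_gauge2 tau a b lam : ric_solvable tau a (- b) (lam + b * (a + 1)) -> ric_solvable tau a b lam.
Proof.
move=> [P [Q [Q0]]]; rewrite jetaN.
have -> : - b = b - 2 * b by ring.
have sb : b * (b - b) = 0 by rewrite subrr mulr0.
have m1 : (-1) ^+ 2 = 1 :> R by rewrite sqrrN expr1n.
move=> /(ricpq_gauge _ _ _ _ _ m1 sb); rewrite -jetaN => h.
by eexists; eexists; split; last exact: h; rewrite mulf_neq0 ?polyXsubC_eq0.
Qed.

(** Flipping both parameters gives the first-order coefficient [4x - h] of the adjoint, so adjoint
    solutions become solutions of the original equation. *)
Lemma ric_solvable_dual tau a b lam : ric_solvable tau (- a) (- b) (lam + a + b) -> ric_solvable tau a b lam.
Proof.
move=> h; apply: ric_solvable_gauge2; apply: ric_solvable_gauge1.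
by rewrite (_ : _ + _ + _ = lam + a + b) //; ring.
Qed.

Lemma sol_ratfun tau a b s t lam y : tau != 0 -> y != 0 ->
  s = 0 \/ s = a -> t = 0 \/ t = b ->
  nop tau (jeta 1 (a - 2 * s) (b - 2 * t)) 1 y
    = (lam + s * (b + 1) + t * (a - 2 * s + 1))%:P * tau ^+ 2 * y ->
  exists w, Ric (Trg tau a b) lam w /\ rnum w * wden tau y = rden w * wnum tau s t y.
Proof.
move=> t0 y0 hs ht /(ricpq_nop _ _ _ t0 y0) h.
have sa : s * (s - a) = 0 by case: hs => ->; rewrite ?mul0r // subrr mulr0.
have tb : t * (t - b) = 0 by case: ht => ->; rewrite ?mul0r // subrr mulr0.
have m1 : (-1) ^+ 2 = 1 :> R by rewrite sqrrN expr1n.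
rewrite jetaN in h; have {}h := (ricpq_gauge _ _ _ _ _ m1 tb).2 h.
rewrite -jetaN in h; have {}h := (ricpq_gauge _ _ _ _ _ (expr1n _ 2) sa).2 h.
have W0 : wden tau y != 0 by rewrite /wden !mulf_neq0 ?polyXsubC_eq0.
have [w wE] := ratfun_ex (wnum tau s t y) W0.
exists w; split; last by rewrite wE mulrC.
apply/Ric_ricpq; apply: (ricpq_cross _ _ _ (rden_neq0 w) W0 wE).2.
move: h; rewrite /wden /wnum.
set P1 := (X in ricpq _ _ _ X _ -> _); set Q1 := (X in ricpq _ _ _ _ X -> _).
set P2 := (X in _ -> ricpq _ _ _ X _); set Q2 := (X in _ -> ricpq _ _ _ _ X).
have -> : P1 = P2 by rewrite /P1 /P2; ring.
by have -> : Q1 = Q2 by rewrite /Q1 /Q2; ring.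
Qed.

Lemma jeta1 e a b : (jeta e a b)`_1 = a + b + 2.
Proof.
by rewrite /jeta coefD !coefCM coefD coefB coefX !coefC /=; ring.
Qed.
End RationalFunctions.

(** * Eigenvalues from the growth at infinity *)

Section QuasiRationalSpectrum.
Variable R : realType.
Variables (tau : {poly R}) (a b : R).
Hypotheses (t1 : tau.[1] != 0) (tm : tau.[-1] != 0).
Hypothesis inv : hasinv tau (jeta 1 a b).
Implicit Types (y z P Q : {poly R}) (lam s t : R) (w : ratfun R).
Local Notation N := (size tau).-1.

Let tau0 : tau != 0.
Proof. by apply: contraNneq t1 => ->; rewrite horner0. Qed.

(** The eigenvalue of a solution growing like the power [x] at infinity; the other exponent there is
    [- c - d - 1 - x]. *)
Definition lamof (c d x : R) : R := x * (x + c + d + 1).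

Definition class s t := (s = 0 \/ s = a) /\ (t = 0 \/ t = b).

Definition sol s t lam y := y != 0 /\
  nop tau (jeta 1 (a - 2 * s) (b - 2 * t)) 1 y
    = (lam + s * (b + 1) + t * (a - 2 * s + 1))%:P * tau ^+ 2 * y.

Lemma class_lam s t x : class s t ->
  lamof a b (x - s - t) + s * (b + 1) + t * (a - 2 * s + 1)
  = x * (x - 1 + ((a - 2 * s) + (b - 2 * t) + 2)).
Proof. by rewrite /lamof => -[[->|->] [->|->]]; ring. Qed.

Lemma chi_jeta c d n : chi tau (jeta 1 c d) 1 n = (n%:R - N%:R) * (n%:R - N%:R - 1 + (c + d + 2)).
Proof. by rewrite /chi jeta1 mul1r. Qed.

Lemma sol_lam s t lam y : class s t -> sol s t lam y ->
  lam = lamof a b ((size y).-1%:R - N%:R - s - t).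
Proof.
move=> cl [y0 /(eig_chi tau0 (size_jeta _ _ _) y0)]; rewrite chi_jeta -class_lam //.
by move=> /(addIr _)/(addIr _).
Qed.

Lemma lamof_sym c d x : lamof c d (- c - d - 1 - x) = lamof c d x.
Proof. by rewrite /lamof; ring. Qed.

Lemma lamof_eq c d (x y : R) : lamof c d x = lamof c d y -> x = y \/ x = - c - d - 1 - y.
Proof.
move=> /eqP; rewrite -subr_eq0 [X in X == 0](_ : _ = (x - y) * (x - (- c - d - 1 - y))); last first.
  by rewrite /lamof; ring.
by rewrite mulf_eq0 !subr_eq0 => /orP[]/eqP; [left|right].
Qed.

End QuasiRationalSpectrum.

(** * Solutions for every integer growth *)

Section IntegerClass.
Variable R : realType.
Variables (tau : {poly R}) (a b : R).
Hypotheses (t1 : tau.[1] != 0) (tm : tau.[-1] != 0).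
Hypothesis inv : hasinv tau (jeta 1 a b).
Local Notation N := (size tau).-1.

Let tau0 : tau != 0.
Proof. by apply: contraNneq t1 => ->; rewrite horner0. Qed.

Lemma ric_solvable_max (m : int) :
  (forall j : int, m < j -> lamof a b j%:~R != lamof a b m%:~R) ->
  ric_solvable tau a b (lamof a b m%:~R).
Proof.
move=> hj; set lam := lamof _ _ _.
have [K [S iS]] := inv.
(* For constant [tau] there are eigenpolynomials in all degrees: those for [(a, b)] serve [m >= 0],
   those for [(- a, - b)] serve [m < 0]. *)
have [N0|N0] := posnP N.
  case: m hj @lam => n hj lam.
    have [|y [Sy y0 ey]] := inv_eigenpoly tau0 (size_jeta _ _ _) iS (n := n); first by rewrite N0 muln0.
    apply: (ric_solvable_nop tau0 y0 (c := 1)); rewrite ey; congr (_%:P * _ * _).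
    by rewrite chi_jeta N0 /lam /lamof -pmulrn; ring.
  apply: ric_solvable_dual.
  have inv' : hasinv tau (jeta 1 (- a) (- b)) by apply: hasinv_flip2 => //; apply: hasinv_flip1.
  have [K' [S' iS']] := inv'.
  have [|y [Sy y0 ey]] := inv_eigenpoly tau0 (size_jeta _ _ _) iS' (n := n); first by rewrite N0 muln0.
  apply: (ric_solvable_nop tau0 y0 (c := 1)); rewrite ey; congr (_%:P * _ * _).
  by rewrite chi_jeta N0 /lam /lamof NegzE mulrNz -pmulrn -natr1; ring.
(* Fredholm alternative on [S]: a kernel element, or a solution of the adjoint equation. *)
have [[y [Sy y0 ey]]|nex] := pselect (exists y, [/\ S y, y != 0 &
    nop tau (jeta 1 a b) 1 y = lam%:P * tau ^+ 2 * y]).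
  exact: (ric_solvable_nop tau0 y0 ey).
have inj y : S y -> nop tau (jeta 1 a b) 1 y = lam%:P * tau ^+ 2 * y -> y = 0.
  by move=> Sy ey; apply/eqP/negPn/negP => y0; apply: nex; exists y.
have lE (j : int) : j%:~R * (j%:~R - 1 + (jeta 1 a b)`_1) = lamof a b j%:~R.
  by rewrite jeta1 /lamof; ring.
have [||Z Z0 eZ] := dual_solution tau0 (size_jeta _ _ _) iS (m := m) N0 inj.
- by rewrite lE.
- by move=> j; rewrite lE; apply: hj.
apply: ric_solvable_dual; apply: (ric_solvable_nop tau0 Z0 (c := K%:R)).
have hE : jeta 1 (- a) (- b) = 4 * 'X - jeta 1 a b by rewrite /jeta; ring.
by rewrite hE eZ jeta1; congr (_%:P * _ * _); ring.
Qed.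

(** A value of the quadratic [lamof] is taken by at most two integers, and the larger one satisfies
    the condition of [ric_solvable_max]. *)
Lemma ric_solvable_int (i : int) : ric_solvable tau a b (lamof a b i%:~R).
Proof.
have [[j [ij ej]]|nj] := pselect (exists j : int, i < j /\ lamof a b j%:~R = lamof a b i%:~R).
  rewrite -ej; apply: ric_solvable_max => k jk; apply/eqP => ek.
  have ji : (j%:~R : R) != i%:~R by rewrite eqr_int gt_eqF.
  have kj : (k%:~R : R) != j%:~R by rewrite eqr_int gt_eqF.
  have ki : (k%:~R : R) != i%:~R by rewrite eqr_int gt_eqF // (lt_trans ij).
  have [/eqP|E1] := lamof_eq ej; first by rewrite (negPf ji).
  have [/eqP|E2] := lamof_eq ek; first by rewrite (negPf kj).
  by move: ki; rewrite E2 E1; case/eqP; ring.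
apply: ric_solvable_max => j ij; apply/eqP => ej; apply: nj; by exists j.
Qed.
End IntegerClass.

(** * The quasi-rational spectrum *)

Section Spectrum.
Variable R : realType.
Variables (tau : {poly R}) (a b : R).
Hypotheses (t1 : tau.[1] != 0) (tm : tau.[-1] != 0).
Hypothesis inv : hasinv tau (jeta 1 a b).
Local Notation N := (size tau).-1.

Lemma sigma_qrP lam : sigma_qr (Trg tau a b) lam <->
  exists i : int, lam = lamof a b i%:~R \/ lam = lamof a b (i%:~R - a).
Proof.
rewrite sigma_ric_solvable; split=> [[P [Q [Q0 h]]]|[i [->|->]]]; last first.
- apply: ric_solvable_gauge1.
  have inv' : hasinv tau (jeta 1 (- a) b) by apply: hasinv_flip1.
  by have := ric_solvable_int t1 tm inv' i; rewrite (_ : lamof _ _ _ = lamof a b (i%:~R - a) + a * (b + 1)) // /lamof; ring.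
- exact: ric_solvable_int.
have [w wE] := ratfun_ex P Q0.
have hw := (ricpq_cross _ _ _ (rden_neq0 w) Q0 wE).2 h.
have [s [t [y [cl _ [y0 _ _] _ ey]]]] := ric_class t1 tm inv (ratfun_coprime w) (rden_neq0 w) hw.
have := sol_lam t1 cl (conj y0 ey); set n := (size y).-1 => ->.
have e0 : (n%:Z - N%:Z)%:~R = n%:R - N%:R :> R by rewrite intrB -!pmulrn.
case: cl => -[->|->] [->|->].
- by exists (n%:Z - N%:Z); left; rewrite e0 !subr0.
- exists (N%:Z - n%:Z - 1); right; rewrite -lamof_sym !intrB -!pmulrn; congr lamof; ring.
- by exists (n%:Z - N%:Z); right; rewrite e0 subr0.
- exists (N%:Z - n%:Z - 1); left; rewrite -lamof_sym !intrB -!pmulrn; congr lamof; ring.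
Qed.
End Spectrum.

(** * Types of solutions away from finitely many eigenvalues *)

Section Labels.
Variable R : realType.
Variables (tau : {poly R}) (a b : R).
Hypotheses (t1 : tau.[1] != 0) (tm : tau.[-1] != 0).
Hypothesis inv : hasinv tau (jeta 1 a b).
Implicit Types (y z P Q : {poly R}) (lam s t e : R) (w : ratfun R).
Local Notation N := (size tau).-1.
Local Notation class := (class a b).
Local Notation sol := (sol tau a b).
Local Notation lamof := (lamof a b).

Let tau0 : tau != 0.
Proof. by apply: contraNneq t1 => ->; rewrite horner0. Qed.

Definition tcode (p q : bool) : nat :=
  match p, q with
  | false, false => 1%N | true, true => 2%N | true, false => 3%N | false, true => 4%N
  end.

Lemma tcode_inj p q p' q' : tcode p q = tcode p' q' -> p = p' /\ q = q'.
Proof. by case: p; case: q; case: p'; case: q'. Qed.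

(** The local exponent is [- s], so the minimum selects the larger of [0] and [- c]; a non-integer
    [c] imposes nothing. *)
Definition good (c s : R) := forall z : int, c = z%:~R -> s = Num.min 0 c.

(* The label type k occurs at lam for the generic exponents: at an integer
   parameter only the larger local exponent occurs, and at infinity the larger
   one. *)
Definition canonical_type (k : nat) lam := exists s t (i : int),
  [/\ class s t, good a s /\ good b t, lam = lamof (i%:~R - s - t),
      0 < 2 * (i%:~R - s - t) + a + b + 1 & k = tcode (s != 0) (t != 0)].

Lemma ric_sol w lam : Ric (Trg tau a b) lam w -> exists s t y,
  [/\ class s t, sol s t lam y, y.[1] != 0 /\ y.[-1] != 0,
      atype w = tcode (s != 0) (t != 0) &
      rnum w * wden tau y = rden w * wnum tau s t y].
Proof.
move=> /Ric_ricpq h.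
have [s [t [y [cl [sE tE] [y0 y1 ym] wE ey]]]] :=
  ric_class t1 tm inv (ratfun_coprime w) (rden_neq0 w) h.
by exists s, t, y; split=> //; rewrite /atype sE tE /tcode; case: (root _ 1); case: (root _ _).
Qed.

(** Both expressions give the residue of one function at [e]: it is [m - s], with [m] the
    multiplicity of [e] in [y], and also [- s']. *)
Lemma exponent_diff e (d : {poly R}) P Q s s' t t' y y' :
  tau.[e] != 0 -> d.[e] != 0 -> Q != 0 -> y != 0 -> y'.[e] != 0 ->
  P * (y * tau * (('X - e%:P) * d)) = Q * (dl tau 1 y * (('X - e%:P) * d)
     - (s%:P * d + t%:P * ('X - e%:P)) * (y * tau)) ->
  P * (y' * tau * (('X - e%:P) * d)) = Q * (dl tau 1 y' * (('X - e%:P) * d)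
     - (s'%:P * d + t'%:P * ('X - e%:P)) * (y' * tau)) ->
  exists m : nat, s - s' = m%:R.
Proof.
move=> te de Q0 y0 y'e E E'; set c := 'X - e%:P in E E'.
have c0 : c != 0 by rewrite polyXsubC_eq0.
have d0 : d != 0 by apply: contraNneq de => ->; rewrite horner0.
have tau0' := tau0.
have [m [r [yE]]] := irredp_factorX (irredp_XsubC e) y0; rewrite dvdp_XsubCl => rr.
exists m; rewrite -/c in yE.
have key : (tau * (m%:R * r + c * r^`()) * d - tau^`() * r * (c * d) - (s%:P * d + t%:P * c) * (r * tau)) * y'
   = (dl tau 1 y' * (c * d) - (s'%:P * d + t'%:P * c) * (y' * tau)) * r.
  apply: (@mulfI _ (Q * tau * c ^+ m * (c * d))); first by rewrite !mulf_neq0 ?expf_neq0.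
  transitivity (Q * (dl tau 1 y * (c * d) - (s%:P * d + t%:P * c) * (y * tau)) * (y' * tau * (c * d))).
    transitivity (Q * ((tau * (m%:R * 1 * c ^+ m * r + c * c ^+ m * r^`()) * d - tau^`() * (c ^+ m * r) * (c * d)
      - (s%:P * d + t%:P * c) * (c ^+ m * r * tau))) * (y' * tau * (c * d))); first by ring.
    have cX := mulp_derivX c m; rewrite /c derivXsubC -/c in cX.
    by rewrite -cX yE /dl derivM; ring.
  rewrite -E; transitivity (P * (y' * tau * (c * d)) * (y * tau * (c * d))); first by ring.
  by rewrite E' yE; ring.
have := congr1 (fun p => p.[e]) key.
rewrite /c !(hornerXsubC, hornerM, hornerD, hornerN, hornerC) subrr -polyC_natr hornerC.
rewrite !(mul0r, mulr0, addr0, subr0, sub0r) => ev.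
apply/eqP; rewrite -subr_eq0; apply/eqP.
have nz : tau.[e] * d.[e] * r.[e] * y'.[e] != 0 by rewrite !mulf_neq0 // -rootE.
apply: (mulfI nz); rewrite mulr0; apply/eqP; rewrite -oppr_eq0; apply/eqP.
move: ev => /eqP; rewrite -subr_eq0 => /eqP ev; rewrite -[RHS]ev; ring.
Qed.

Lemma wnum_swap s t y : wnum tau s t y =
  dl tau 1 y * (('X - (-1)%:P) * ('X - 1%:P)) - (t%:P * ('X - 1%:P) + s%:P * ('X - (-1)%:P)) * (y * tau).
Proof. by rewrite /wnum; ring. Qed.

Lemma class_unique w s t s' t' y y' : y != 0 -> y'.[1] != 0 -> y'.[-1] != 0 ->
  rnum w * wden tau y = rden w * wnum tau s t y ->
  rnum w * wden tau y' = rden w * wnum tau s' t' y' ->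
  (exists m : nat, s - s' = m%:R) /\ (exists m : nat, t - t' = m%:R).
Proof.
move=> y0 y'1 y'm E E'; have n2 : 1 + 1 != 0 :> R by rewrite -[1 + 1]/(2%:R) pnatr_eq0.
have Q0 := rden_neq0 w; split.
  apply: (exponent_diff t1 _ Q0 y0 y'1 E E').
  by rewrite hornerXsubC opprK.
have sw z : wden tau z = z * tau * (('X - (-1)%:P) * ('X - 1%:P)) by rewrite /wden; ring.
rewrite sw wnum_swap in E; rewrite sw wnum_swap in E'.
apply: (exponent_diff tm _ Q0 y0 y'm E E').
by rewrite hornerXsubC -opprD oppr_eq0.
Qed.

(** The wrong exponent at an integer parameter gives a solution nonvanishing at [e] for the
    parameter [- r], the case treated by [bad_spectrum]. *)
Lemma bad_spectrum_class e c : e ^+ 2 = 1 -> tau.[e] != 0 -> exists B : seq R,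
  forall s d lam y, s = 0 \/ s = c -> d \in [:: b; - b; a; -a] ->
   nop tau (jeta e (c - 2 * s) d) 1 y = lam%:P * tau ^+ 2 * y -> y.[e] != 0 ->
   lam \notin B -> good c s.
Proof.
move=> e2 te.
have [[z zE]|nz] := pselect (exists z : int, c = z%:~R); last first.
  by exists [::] => s d lam y _ _ _ _ _ z zE; case: nz; exists z.
pose r := `|z|%N.
have aux (ds : seq R) : exists B : seq R, forall d lam y, d \in ds ->
    nop tau (jeta e (- r%:R) d) 1 y = lam%:P * tau ^+ 2 * y -> y.[e] != 0 -> (0 < r)%N -> lam \in B.
  elim: ds => [|d0 ds [B hB]]; first by exists [::].
  have [B0 hB0] := bad_spectrum d0 r e2 te.
  exists (B0 ++ B) => d lam y; rewrite inE mem_cat => /orP[/eqP->|dds] ey ye r0.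
    by rewrite (hB0 lam y).
  by rewrite (hB d lam y) // orbT.
have [B hB] := aux [:: b; - b; a; - a].
exists B => s d lam y hs hd ey ye lamB z' _.
have [z0|z0|z0] := ltgtP z 0.
- have c0 : c < 0 by rewrite zE ltrz0.
  rewrite min_r ?ltW //; case: hs => // s0; case/negP: lamB.
  apply: (hB d lam y hd _ ye); last by rewrite /r absz_gt0 lt_eqF.
  by rewrite -ey s0 mulr0 subr0 /r zE -{2}(opprK z) -(ltz0_abs z0) mulrNz.
- have c0 : 0 < c by rewrite zE ltr0z.
  rewrite min_l ?ltW //; case: hs => // sc; case/negP: lamB.
  apply: (hB d lam y hd _ ye); last by rewrite /r absz_gt0 gt_eqF.
  rewrite -ey sc; congr (nop _ (jeta _ _ _) _ _).
  by rewrite (_ : c - 2 * c = - c); [rewrite /r zE -{2}(gtz0_abs z0) | ring].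
- by rewrite zE z0 in hs *; rewrite minxx; case: hs.
Qed.

Lemma class_mem s t : class s t ->
  (a - 2 * s \in [:: b; - b; a; - a]) && (b - 2 * t \in [:: b; - b; a; - a]).
Proof.
have h (c : R) : c - 2 * c = - c by ring.
by move=> [[->|->] [->|->]]; rewrite !inE ?h ?mulr0 ?subr0 !eqxx ?orbT.
Qed.

Lemma good_spectrum : exists B : seq R, forall lam s t y, lam \notin B -> class s t ->
  sol s t lam y -> y.[1] != 0 -> y.[-1] != 0 -> good a s /\ good b t.
Proof.
have m1 : (-1) ^+ 2 = 1 :> R by rewrite sqrrN expr1n.
have [B1 h1] := bad_spectrum_class a (expr1n _ 2) t1.
have [B2 h2] := bad_spectrum_class b m1 tm.
(* Translates an eigenvalue of the conjugated operator back to one of the original operator. *)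
pose sh (p : R * R) (mu : R) := mu - (p.1 * (b + 1) + p.2 * (a - 2 * p.1 + 1)).
exists [seq sh p mu | p <- [:: (0, 0); (a, 0); (0, b); (a, b)], mu <- B1 ++ B2].
move=> lam s t y lamB cl [y0 ey] y1 ym.
set mu := _ + _ + _ in ey.
have muB : mu \notin B1 ++ B2.
  apply: contra lamB => muB; apply/allpairsP; exists ((s, t), mu); split=> //=.
    by case: cl => -[->|->] [->|->]; rewrite !inE !eqxx ?orbT.
  by rewrite /sh /mu /=; ring.
move: muB; rewrite mem_cat negb_or => /andP[mu1 mu2].
have /andP[ma mb] := class_mem cl; split.
  by apply: (h1 s (b - 2 * t) mu y); case: cl.
by apply: (h2 t (a - 2 * s) mu y); rewrite -?jetaN //; case: cl.
Qed.

Lemma good_unique c s s' : s = 0 \/ s = c -> s' = 0 \/ s' = c -> good c s -> good c s' ->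
  (exists m : nat, s - s' = m%:R) -> s = s'.
Proof.
move=> hs hs' g g' [m sm].
have [[z zE]|nz] := pselect (exists z : int, c = z%:~R).
  by rewrite (g z zE) (g' z zE).
case: hs sm => ->; case: hs' => -> // sm; case: nz.
  by exists (- m%:Z); rewrite mulrNz -pmulrn -sm; ring.
by exists m%:Z; rewrite -pmulrn -sm; ring.
Qed.

Lemma labels : exists B : seq R, forall lam, lam \notin B ->
  (forall w w', Ric (Trg tau a b) lam w -> Ric (Trg tau a b) lam w' -> atype w = atype w' -> w = w') /\
  (forall k, (exists w, Ric (Trg tau a b) lam w /\ atype w = k) <-> canonical_type k lam).
Proof.
have [Bg hBg] := good_spectrum.
have [K hK] : exists K, forall s t, class s t -> exists K' S,
    (K' <= K)%N /\ invsub tau (jeta 1 (a - 2 * s) (b - 2 * t)) K' S.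
  have H s t : class s t -> exists K' S, invsub tau (jeta 1 (a - 2 * s) (b - 2 * t)) K' S.
    by move=> [hs ht]; apply: hasinv_class.
  have [|k1 [S1 h1]] := H 0 0; [by split; left|].
  have [|k2 [S2 h2]] := H a 0; [by split; [right|left]|].
  have [|k3 [S3 h3]] := H 0 b; [by split; [left|right]|].
  have [|k4 [S4 h4]] := H a b; [by split; right|].
  exists (k1 + k2 + k3 + k4)%N => s t [[->|->] [->|->]].
  - by exists k1, S1; split=> //; lia.
  - by exists k3, S3; split=> //; lia.
  - by exists k2, S2; split=> //; lia.
  - by exists k4, S4; split=> //; lia.
(* An integer [i > Y] makes [i - s - t] the larger growth in every class; beyond [X],
   eigenpolynomials also exist by [inv_eigenpoly]. *)
pose Y := Num.bound (`|a| + `|b| + 1); pose X := (K * N + N + Y)%N.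
have hY : `|a| + `|b| + 1 < Y%:R by apply: archi_boundP; rewrite !addr_ge0.
have YX : Y%:R <= X%:R :> R by rewrite ler_nat /X leq_addl.
have bnd s t : class s t -> [/\ - `|a| <= 2 * s - a, 2 * s - a <= `|a|, - `|b| <= 2 * t - b & 2 * t - b <= `|b|].
  have ha1 := ler_norm a; have ha2 := ler_norm (- a); rewrite normrN in ha2.
  have hb1 := ler_norm b; have hb2 := ler_norm (- b); rewrite normrN in hb2.
  by move=> [[->|->] [->|->]]; split; lra.
pose B1 := [seq lamof (j%:R - X%:R - p.1 - p.2) | p <- [:: (0, 0); (a, 0); (0, b); (a, b)], j <- iota 0 X.*2.+1].
have inB1 s t (i : int) : class s t -> (- X%:Z <= i) -> (i <= X%:Z) -> lamof (i%:~R - s - t) \in B1.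
  move=> cl iX Xi; apply/allpairsP; exists ((s, t), `|(i + X%:Z)%R|%N); split.
  - by rewrite /=; case: cl => -[->|->] [->|->]; rewrite !inE !eqxx ?orbT.
  - by rewrite mem_iota /=; lia.
  rewrite /=; have e0 : `|(i + X%:Z)%R|%N%:Z = i + X%:Z by rewrite gez0_abs //; lia.
  have -> : `|(i + X%:Z)%R|%N%:R = (i + X%:Z)%:~R :> R by rewrite -e0 -pmulrn.
  by rewrite intrD -pmulrn addrK.
exists (Bg ++ B1) => lam; rewrite mem_cat negb_or => /andP[lamg lam1].
have big s t y : class s t -> sol s t lam y -> (X + N < (size y).-1)%N.
  move=> cl sy; rewrite ltnNge; apply: contra lam1 => sX.
  have := sol_lam t1 cl sy => ->.
  have -> : (size y).-1%:R - N%:R = ((size y).-1%:Z - N%:Z)%:~R :> R by rewrite intrB -!pmulrn.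
  by apply: inB1 => //; rewrite /X in sX *; move: sX; move: (size y).-1 (K * N)%N N => u v n; lia.
have sizeE s t y y' : class s t -> sol s t lam y -> sol s t lam y' -> (size y).-1 = (size y').-1.
  move=> cl sy sy'; have := big _ _ _ cl sy; have := big _ _ _ cl sy'.
  have e := sol_lam t1 cl sy; rewrite (sol_lam t1 cl sy') in e.
  move: e; set n := (size y).-1; set n' := (size y').-1 => e.
  rewrite -!(ltr_nat R) [(X + N)%:R]natrD => ln ln'.
  (* Either the degrees agree, or one growth is the mirror image of the other, which is impossible
     as both are large. *)
  have [E|E] := lamof_eq e.
    have : n%:R = n'%:R :> R by move: E; lra.
    by move=> /eqP; rewrite eqr_nat => /eqP.
  by exfalso; have [u1 u2 u3 u4] := bnd s t cl; move: E ln ln'; lra.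
have scal s t y y' : class s t -> sol s t lam y -> sol s t lam y' ->
    exists2 c : R, c != 0 & y = c%:P * y'.
  move=> cl sy sy'; have [y0 y'0] := (sy.1, sy'.1).
  pose c := lead_coef y / lead_coef y'.
  have c0 : c != 0 by rewrite mulf_neq0 ?invr_eq0 ?lead_coef_eq0.
  (* A nonzero difference would be a solution of smaller degree in the same class, against
     [sizeE]. *)
  exists c => //; apply/eqP; rewrite -subr_eq0; apply/negPn/negP => z0.
  have sz : sol s t lam (y - c%:P * y').
    by split=> //; rewrite nopB nopZ sy.2 sy'.2; ring.
  have ty' := top_lead y'0; rewrite -(sizeE _ _ _ _ cl sy sy') in ty'.
  have := topB (top_lead y0) (topM (topC c) ty').
  rewrite divfK ?lead_coef_eq0 // subrr => /top0_size.
  rewrite (sizeE _ _ _ _ cl sy sz); move: (size_poly_gt0 (y - c%:P * y')); rewrite z0.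
  by move: (size _) => u; case: u => //= u _; rewrite ltnn.
have classE s t s' t' : class s t -> class s' t' -> tcode (s != 0) (t != 0) = tcode (s' != 0) (t' != 0) -> s = s' /\ t = t'.
  have aux (x u u' : R) : u = 0 \/ u = x -> u' = 0 \/ u' = x -> (u != 0) = (u' != 0) -> u = u'.
    by move=> [->|->] [->|->] //; rewrite eqxx; [move=> /esym|]; move=> /negbFE/eqP.
  by move=> [hs ht] [hs' ht'] /tcode_inj[e1 e2]; split; [apply: (aux a) | apply: (aux b)].
split=> [w w' hw hw' E|k]; last split.
- have [s [t [y [cl sy _ aE wE]]]] := ric_sol hw.
  have [s' [t' [y' [cl' sy' _ aE' wE']]]] := ric_sol hw'.
  rewrite aE aE' in E; have [es et] := classE _ _ _ _ cl cl' E; subst s' t'.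
  have [c c0 ey] := scal _ _ _ _ cl sy sy'.
  apply: ratfun_eq; have W0 : wden tau y' * c%:P != 0.
    by rewrite /wden !mulf_neq0 ?polyXsubC_eq0 ?polyC_eq0 //; case: sy'.
  apply: (mulIf W0).
  have wd : wden tau y = wden tau y' * c%:P by rewrite ey /wden; ring.
  have wn : wnum tau s t y = wnum tau s t y' * c%:P by rewrite ey /wnum /dl derivM derivC; ring.
  rewrite wd wn in wE.
  transitivity (rden w' * (rnum w * (wden tau y' * c%:P))); first by ring.
  rewrite wE; transitivity (c%:P * rden w * (rden w' * wnum tau s t y')); first by ring.
  by rewrite -wE'; ring.
- move=> [w [hw <-]]; have [s [t [y [cl sy [y1 ym] -> _]]]] := ric_sol hw.
  have ln := big _ _ _ cl sy.
  exists s, t, ((size y).-1%:Z - N%:Z).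
  have e0 : ((size y).-1%:Z - N%:Z)%:~R = (size y).-1%:R - N%:R :> R by rewrite intrB -!pmulrn.
  rewrite e0; split=> //; [exact: (hBg lam s t y) | exact: sol_lam |].
  have [u1 u2 u3 u4] := bnd s t cl.
  by move: ln; rewrite -(ltr_nat R) natrD => ln; move: hY YX; lra.
move=> [s [t [i [cl [ga gb] lE ipos ->]]]].
have [u1 u2 u3 u4] := bnd s t cl.
have iX : - X%:Z <= i.
  rewrite leNgt; apply/negP => iX.
  have : i%:~R < - X%:R :> R by rewrite [X%:R]pmulrn -mulrNz ltr_int.
  by move: ipos hY YX; lra.
have Xi : X%:Z < i by rewrite ltNge; apply: contra lam1 => Xi; rewrite lE; apply: inB1.
have [K' [S [K'K iS]]] := hK s t cl.
pose n := `|(i + N%:Z)%R|%N.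
have nE : n%:Z = i + N%:Z.
  by rewrite /n gez0_abs // addr_ge0 // ltW // (le_lt_trans _ Xi).
have nR : n%:R - N%:R = i%:~R :> R.
  have h : (n%:Z)%:~R = (i + N%:Z)%:~R :> R by rewrite nE.
  by move: h; rewrite intrD -!pmulrn => ->; rewrite addrK.
have [|y [Sy y0 ey]] := inv_eigenpoly tau0 (size_jeta _ _ _) iS (n := n).
  have h1 : (K' * N <= K * N)%N by rewrite leq_mul2r K'K orbT.
  have h2 : (K' * N)%:Z <= X%:Z by rewrite lez_nat (leq_trans h1) // /X -addnA leq_addr.
  by rewrite -lez_nat nE (le_trans h2) // (le_trans (ltW Xi)) // lerDl.
have sy : sol s t lam y.
  split=> //; rewrite ey chi_jeta nR lE; congr (_%:P * _ * _).
  by rewrite (class_lam _ cl).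
have [w [hw wE]] := sol_ratfun tau0 y0 cl.1 cl.2 sy.2.
exists w; split=> //.
(* The polynomial [y] may vanish at 1 or -1, so the type of [w] is read from a nonvanishing [y'];
   goodness forces the same exponents. *)
have [s' [t' [y' [cl' sy' [y'1 y'm] -> wE']]]] := ric_sol hw.
have [d1 d2] := class_unique y0 y'1 y'm wE wE'.
have [ga' gb'] := hBg lam s' t' y' lamg cl' sy' y'1 y'm.
by rewrite (good_unique cl.1 cl'.1 ga ga' d1) (good_unique cl.2 cl'.2 gb gb' d2).
Qed.
End Labels.

(** * From matching types to equal labels, and the conclusion *)

Lemma Ric_irrelevance (R : realType) (T : rop R) (lam : R) (x y : {w | Ric T lam w}) :
  sval x = sval y -> x = y.
Proof. by case: x y => [w hw] [w' hw'] /= e; subst w'; congr exist; apply: Prop_irrelevance. Qed.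

(** When types separate the solutions on both sides, sending each solution to the one of the same
    type is a bijection. *)
Lemma same_label_of_types (R : realType) (T1 T2 : rop R) (l1 l2 : R) :
  (forall w w', Ric T1 l1 w -> Ric T1 l1 w' -> atype w = atype w' -> w = w') ->
  (forall w w', Ric T2 l2 w -> Ric T2 l2 w' -> atype w = atype w' -> w = w') ->
  (forall k, (exists w, Ric T1 l1 w /\ atype w = k) <-> (exists w, Ric T2 l2 w /\ atype w = k)) ->
  same_label T1 l1 T2 l2.
Proof.
move=> i1 i2 h; split=> //.
have F (x : {w | Ric T1 l1 w}) : {y : {w | Ric T2 l2 w} | atype (sval y) = atype (sval x)}.
  apply: cid; have [w [hw e]] := (h _).1 (ex_intro _ _ (conj (svalP x) erefl)).
  by exists (exist _ w hw).
have G (x : {w | Ric T2 l2 w}) : {y : {w | Ric T1 l1 w} | atype (sval y) = atype (sval x)}.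
  apply: cid; have [w [hw e]] := (h _).2 (ex_intro _ _ (conj (svalP x) erefl)).
  by exists (exist _ w hw).
exists (fun x => sval (F x)), (fun y => sval (G y)); split=> x; apply: Ric_irrelevance.
  by apply: i1; [exact: svalP | exact: svalP | rewrite (svalP (G _)) (svalP (F _))].
by apply: i2; [exact: svalP | exact: svalP | rewrite (svalP (F _)) (svalP (G _))].
Qed.

Theorem mainTheorem4 (R : realType) (tau : {poly R}) (al be : R) :
  exceptional tau al be ->
  exists a b c : R,
    (forall mu : R, sigma_qr (Trg tau al be) mu <->
                    exists lam, sigma_qr (Tjac a b) lam /\ mu = lam + c) /\
    exists s : seq R, forall lam : R, sigma_qr (Tjac a b) lam -> lam \notin s ->
      same_label (Trg tau al be) (lam + c) (Tjac a b) lam.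
Proof.
move=> exc; have [t1 [tm _]] := exc.
have tau0 : tau != 0 by apply: contraNneq t1 => ->; rewrite horner0.
have inv := exceptional_hasinv tau0 exc.
have c1 (x : R) : (1 : {poly R}).[x] != 0 by rewrite hornerC oner_neq0.
have inv1 := hasinv1 (jeta 1 al be).
have sE lam : sigma_qr (Tjac al be) lam <-> sigma_qr (Trg tau al be) lam.
  rewrite (sigma_qrP t1 tm inv) -(sigma_qrP (c1 1) (c1 (-1)) inv1).
  by split=> -[w /Ric_Tjac h]; exists w.
exists al, be, 0; split.
  move=> mu; split=> [h|[lam [h ->]]]; last by rewrite addr0; apply/sE.
  by exists mu; rewrite addr0; split=> //; apply/sE.
have [B hB] := labels t1 tm inv; have [B' hB'] := labels (c1 1) (c1 (-1)) inv1.
exists (B ++ B') => lam _; rewrite mem_cat negb_or addr0 => /andP[lB lB'].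
have [i1 k1] := hB lam lB; have [i2 k2] := hB' lam lB'.
apply: same_label_of_types => //.
  by move=> w w' /Ric_Tjac h /Ric_Tjac h'; apply: i2.
move=> k; rewrite k1 -k2.
by split=> -[w [/Ric_Tjac h e]]; exists w.
Qed.
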